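(* Let $m\geqslant 1$, let $R$ be a finite subset of the free group $\mathbb{F}_m$, and let $G=\mathbb{F}_m/\langle R\rangle$. Suppose that $G$ is amenable. Then $R$ is weakly stable (in permutations) if and only if $G$ is residually finite.
   Context: $\mathbb{F}_m$ is the free group with free generators $x_1,\ldots,x_m$, $l\colon\mathbb{F}_m\to\mathbb{N}$ is the word length function with respect to these generators, and $\langle R\rangle$ is the normal subgroup of $\mathbb{F}_m$ generated by $R$. For a group $H$, elements $p_1,\ldots,p_m\in H$ and $\xi\in\mathbb{F}_m$, $\xi(p_1,\ldots,p_m)\in H$ denotes the image of $\xi$ under the homomorphism $\mathbb{F}_m\to H$ with $x_i\mapsto p_i$. $\mathrm{Sym}(n)$ is the symmetric group on $n$ points with identity $\mathrm{id}_n$, equipped with the normalized Hamming distance $d_H(p,q)=\frac1n\,\mathrm{Card}\{i:p(i)\neq q(i)\}$. Permutations $p_1,\ldots,p_m\in \mathrm{Sym}(n)$ are a solution of $R$ if $\xi(p_1,\ldots,p_m)=\mathrm{id}_n$ for all $\xi\in R$. For $\delta>0$, they are a $\delta$-strong solution of $R$ if for every $\xi\in\mathbb{F}_m$ with $l(\xi)<1/\delta$: if $\xi\in\langle R\rangle$ then $d_H(\xi(p_1,\ldots,p_m),\mathrm{id}_n)<\delta$, and if $\xi\notin\langle R\rangle$ then $d_H(\xi(p_1,\ldots,p_m),\mathrm{id}_n)>1-\delta$. $R$ is weakly stable (in permutations) if for every $\varepsilon>0$ there exists $\delta>0$ such that for every integer $n\geqslant1$ and every $\delta$-strong solution $p_1,\ldots,p_m\in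 \mathrm{Sym}(n)$ of $R$ there exists a solution $\tilde p_1,\ldots,\tilde p_m\in \mathrm{Sym}(n)$ of $R$ with $d_H(p_i,\tilde p_i)<\varepsilon$ for all $i=1,\ldots,m$. *)

(* Defs.v *)
From HB Require Import structures.
From mathcomp Require Import all_boot all_order all_algebra all_fingroup.
From mathcomp Require Import all_classical all_reals.
From mathcomp Require Import generic_quotient.

Set Implicit Arguments.
Unset Strict Implicit.
Unset Printing Implicit Defensive.

Import Order.TTheory GRing.Theory Num.Theory.
Local Open Scope classical_set_scope.
Local Open Scope ring_scope.

(* The free group on x_1, ..., x_m, realized as the set of reduced words. The
   letter (i, false) stands for x_i and (i, true) for its inverse. *)

Notation letter m := ('I_m * bool)%type.

Definition letter_inv m (a : letter m) : letter m := (a.1, ~~ a.2).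

Definition reduced m : pred (seq (letter m)) :=
  sorted (fun a b => b != letter_inv a).

Definition reduced_cons m (a : letter m) (w : seq (letter m)) :=
  if w is b :: w' then if b == letter_inv a then w' else a :: w
  else [:: a].

Definition reduce m (w : seq (letter m)) : seq (letter m) :=
  foldr (@reduced_cons m) [::] w.

Definition word_inv m (w : seq (letter m)) : seq (letter m) :=
  rev (map (@letter_inv m) w).

Record free_group (m : nat) : Type :=
  FreeGroup { fg_word : seq (letter m); fg_reduced : reduced fg_word }.

HB.instance Definition _ m := [isSub for @fg_word m].
HB.instance Definition _ m := [Choice of free_group m by <:].

Section FreeGroupTheory.
Variable m : nat.
Implicit Types (a b : letter m) (u v w : seq (letter m)).

Lemma letter_invK : involutive (@letter_inv m).
Proof. by case=> i b; rewrite /letter_inv /= negbK. Qed.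

Lemma reduced_behead a w : reduced (a :: w) -> reduced w.
Proof. exact: path_sorted. Qed.

Lemma reduced_consP a w : reduced w -> reduced (reduced_cons a w).
Proof.
case: w => [|b w] //= rw; case: ifP => [_|nab]; first exact: path_sorted rw.
by rewrite /reduced /= nab.
Qed.

Lemma reduceP w : reduced (reduce w).
Proof. by elim: w => //= a w; apply: reduced_consP. Qed.

Lemma reduced_consE a w : reduced (a :: w) -> reduced_cons a w = a :: w.
Proof. by case: w => [|b w] //= /andP[/negbTE-> _]. Qed.

Lemma reduce_id w : reduced w -> reduce w = w.
Proof.
elim: w => //= a w IH rw; rewrite -/(reduce w) IH ?reduced_consE //.
exact: reduced_behead rw.
Qed.

Lemma reduced_consK a w :
  reduced w -> reduced_cons a (reduced_cons (letter_inv a) w) = w.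
Proof.
case: w => [|b w] /=; first by rewrite eqxx.
rewrite letter_invK; case: eqP => [-> rw|_ _] /=; last by rewrite eqxx.
exact: reduced_consE.
Qed.

Lemma reduced_consVK a w :
  reduced w -> reduced_cons (letter_inv a) (reduced_cons a w) = w.
Proof. by move=> rw; rewrite -{2}[a]letter_invK reduced_consK. Qed.

Lemma reduce_cat u v : reduce (u ++ v) = foldr (@reduced_cons m) (reduce v) u.
Proof. by rewrite /reduce foldr_cat. Qed.

Lemma foldr_reduced u v :
  reduced v -> reduced (foldr (@reduced_cons m) v u).
Proof. by move=> rv; elim: u => //= a u; apply: reduced_consP. Qed.

Lemma foldr_reduced_cons a u v : reduced u -> reduced v ->
  foldr (@reduced_cons m) v (reduced_cons a u) =
  reduced_cons a (foldr (@reduced_cons m) v u).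
Proof.
case: u => [|b u] //= ru rv; case: eqP => [->|] //=.
by rewrite reduced_consK // foldr_reduced.
Qed.

Lemma reduce_catl u v : reduce (reduce u ++ v) = reduce (u ++ v).
Proof.
rewrite !reduce_cat; elim: u => //= a u IH.
by rewrite foldr_reduced_cons ?reduceP // IH.
Qed.

Lemma reduce_catr u v : reduce (u ++ reduce v) = reduce (u ++ v).
Proof. by rewrite !reduce_cat (reduce_id (reduceP v)). Qed.

Lemma reduce_word_inv_cat w v : reduce (word_inv w ++ (w ++ v)) = reduce v.
Proof.
elim: w v => //= a w IH v; rewrite /word_inv /= rev_cons cat_rcons.
rewrite -reduce_catr /= -/(reduce _) reduced_consVK ?reduceP //.
by rewrite reduce_catr IH.
Qed.

Lemma word_invK : involutive (@word_inv m).
Proof.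
move=> w; rewrite /word_inv map_rev revK -map_comp.
by rewrite -[RHS]map_id; apply: eq_map => a /=; rewrite letter_invK.
Qed.

Lemma word_inv_reduced w : reduced w -> reduced (word_inv w).
Proof.
rewrite /reduced /word_inv rev_sorted sorted_map; apply: sub_sorted => a b /=.
by rewrite letter_invK eq_sym.
Qed.

Implicit Types x y z : free_group m.

Definition fg_mul x y : free_group m := FreeGroup (reduceP (fg_word x ++ fg_word y)).
Definition fg_one : free_group m := @FreeGroup m [::] isT.
Definition fg_inv x : free_group m := FreeGroup (word_inv_reduced (fg_reduced x)).

Lemma fg_mulA : associative fg_mul.
Proof.
by move=> x y z; apply: val_inj; rewrite /= reduce_catr reduce_catl catA.
Qed.

Lemma fg_mul1 : left_id fg_one fg_mul.
Proof. by move=> x; apply: val_inj => /=; rewrite reduce_id ?fg_reduced. Qed.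

Lemma fg_mulr1 : right_id fg_one fg_mul.
Proof.
by move=> x; apply: val_inj => /=; rewrite cats0 reduce_id ?fg_reduced.
Qed.

Lemma fg_mulV : left_inverse fg_one fg_inv fg_mul.
Proof.
move=> x; apply: val_inj; rewrite /= -[X in _ ++ X]cats0.
exact: reduce_word_inv_cat.
Qed.

Lemma fg_mulrV : right_inverse fg_one fg_inv fg_mul.
Proof.
move=> x; apply: val_inj; rewrite /= -[X in _ ++ X]cats0.
by rewrite -{1}[fg_word x]word_invK reduce_word_inv_cat.
Qed.

End FreeGroupTheory.

HB.instance Definition _ m := isGroup.Build (free_group m)
  (@fg_mulA m) (@fg_mul1 m) (@fg_mulr1 m) (@fg_mulV m) (@fg_mulrV m).

Definition fg_gen m (i : 'I_m) : free_group m :=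
  @FreeGroup m [:: (i, false)] isT.

Definition word_length m (x : free_group m) : nat := size (fg_word x).

Definition letter_eval m (H : groupType) (p : 'I_m -> H) (a : letter m) : H :=
  (if a.2 then (p a.1)^-1 else p a.1)%g.

Definition fg_eval m (H : groupType) (p : 'I_m -> H) (x : free_group m) : H :=
  (\prod_(a <- fg_word x) letter_eval p a)%g.

Section EvalTheory.
Variables (m : nat) (H : groupType) (p : 'I_m -> H).

Lemma letter_evalV a : letter_eval p (letter_inv a) = (letter_eval p a)^-1%g.
Proof. by case: a => i [] /=; rewrite /letter_eval /= ?invgK. Qed.

Lemma eval_reduce w : (\prod_(a <- reduce w) letter_eval p a =
  \prod_(a <- w) letter_eval p a)%g.
Proof.
elim: w => //= a w IH; rewrite big_cons -IH -/(reduce w).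
case: (reduce w) => [|b v] /=; first by rewrite big_seq1 big_nil mulg1.
by case: eqP => [->|_]; rewrite !big_cons // letter_evalV mulVKg.
Qed.

Lemma fg_evalM : {morph fg_eval p : x y / (x * y)%g}.
Proof. by move=> x y; rewrite /fg_eval /= eval_reduce big_cat. Qed.

Lemma fg_eval1 : fg_eval p 1%g = 1%g.
Proof. by rewrite /fg_eval /= big_nil. Qed.

Lemma fg_eval_gen i : fg_eval p (fg_gen i) = p i.
Proof. by rewrite /fg_eval /= big_seq1. Qed.

End EvalTheory.

HB.instance Definition _ m (H : groupType) (p : 'I_m -> H) :=
  isUMagmaMorphism.Build (free_group m) H (fg_eval p) (fg_eval1 p, fg_evalM p).

Definition normal_subgroup (G : groupType) (N : set G) : Prop :=
  [/\ N 1%g,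
      forall x y, N x -> N y -> N (x * y)%g,
      forall x, N x -> N (x^-1)%g
    & forall x g, N x -> N (x ^ g)%g].

Definition normal_closure (G : groupType) (S : set G) : set G :=
  smallest (@normal_subgroup G) S.

Lemma normal_closureP (G : groupType) (S : set G) :
  normal_subgroup (normal_closure S).
Proof.
split.
- by move=> N [] [].
- by move=> x y Nx Ny N hN; have [[_ NM _ _] _] := hN; apply: NM;
  [exact: Nx | exact: Ny].
- by move=> x Nx N hN; have [[_ _ NV _] _] := hN; apply: NV; exact: Nx.
- by move=> x g Nx N hN; have [[_ _ _ NJ] _] := hN; apply: NJ; exact: Nx.
Qed.

Section Quotient.
Variables (G : groupType) (S : set G).
Local Notation N := (normal_closure S).
Local Open Scope quotient_scope.

Definition eqv_mod (x y : G) : bool := `[< N (x^-1 * y)%g >].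

Lemma eqv_mod_refl : reflexive eqv_mod.
Proof.
by move=> x; apply/asboolP; rewrite mulVg; case: (normal_closureP S).
Qed.

Lemma eqv_mod_sym : symmetric eqv_mod.
Proof.
have [_ _ NV _] := normal_closureP S => x y.
apply/asboolP/asboolP => /NV; by rewrite invgM invgK.
Qed.

Lemma eqv_mod_trans : transitive eqv_mod.
Proof.
have [_ NM _ _] := normal_closureP S => y x z /asboolP xy /asboolP yz.
by apply/asboolP; have := NM _ _ xy yz; rewrite -mulgA mulVKg.
Qed.

Canonical eqv_mod_equiv :=
  EquivRel eqv_mod eqv_mod_refl eqv_mod_sym eqv_mod_trans.

(* The quotient of G by the normal subgroup generated by the arbitrary
   subset S (not only by a subset that is already a normal subgroup). *)
Definition normal_quotient : Type := {eq_quot eqv_mod}.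
HB.instance Definition _ := Choice.on normal_quotient.
HB.instance Definition _ := EqQuotient.on normal_quotient.

Definition qg_one : normal_quotient := lift_cst normal_quotient 1%g.
Definition qg_inv := lift_op1 normal_quotient (fun x : G => x^-1)%g.
Definition qg_mul := lift_op2 normal_quotient (fun x y : G => x * y)%g.

Canonical pi_qg_one := PiConst qg_one.

Lemma pi_qg_inv : {morph \pi_normal_quotient : x / (x^-1)%g >-> qg_inv x}.
Proof.
have [_ NM NV NJ] := normal_closureP S.
move=> x; unlock qg_inv; apply/eqmodP/asboolP; rewrite invgK.
have : eqv_mod x (repr (\pi_normal_quotient x)).
  by apply/eqmodP; rewrite reprK.
move=> /asboolP /NV /(NJ _ (repr (\pi_normal_quotient x))^-1%g).
by rewrite /conjg invgM !invgK -!mulgA mulVKg.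
Qed.
Canonical pi_qg_inv_morph := PiMorph1 pi_qg_inv.

Lemma pi_qg_mul : {morph \pi_normal_quotient : x y / (x * y)%g >-> qg_mul x y}.
Proof.
have [_ NM NV NJ] := normal_closureP S.
move=> x y; unlock qg_mul; apply/eqmodP/asboolP.
have : eqv_mod x (repr (\pi_normal_quotient x)).
  by apply/eqmodP; rewrite reprK.
have : eqv_mod y (repr (\pi_normal_quotient y)).
  by apply/eqmodP; rewrite reprK.
move=> /asboolP hy /asboolP /(NJ _ y) hx; have := NM _ _ hx hy.
by rewrite /conjg invgM !mulgA mulgK.
Qed.
Canonical pi_qg_mul_morph := PiMorph2 pi_qg_mul.

Lemma qg_mulA : associative qg_mul.
Proof.
by move=> x y z; rewrite -[x]reprK -[y]reprK -[z]reprK !piE mulgA.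
Qed.

Lemma qg_mul1 : left_id qg_one qg_mul.
Proof. by move=> x; rewrite -[x]reprK !piE mul1g. Qed.

Lemma qg_mulr1 : right_id qg_one qg_mul.
Proof. by move=> x; rewrite -[x]reprK !piE mulg1. Qed.

Lemma qg_mulV : left_inverse qg_one qg_inv qg_mul.
Proof. by move=> x; rewrite -[x]reprK !piE mulVg. Qed.

Lemma qg_mulrV : right_inverse qg_one qg_inv qg_mul.
Proof. by move=> x; rewrite -[x]reprK !piE mulgV. Qed.

HB.instance Definition _ := isGroup.Build normal_quotient
  qg_mulA qg_mul1 qg_mulr1 qg_mulV qg_mulrV.

Lemma pi_qg_eq1 (x : G) : \pi_normal_quotient x = 1%g <-> N x.
Proof.
have [_ _ NV _] := normal_closureP S.
have -> : (1%g : normal_quotient) = \pi_normal_quotient 1%g.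
  by rewrite -[LHS]/qg_one piE.
split=> [/eqmodP/asboolP|Nx]; first by rewrite mulg1 => /NV; rewrite invgK.
by apply/eqmodP/asboolP; rewrite mulg1; apply: NV.
Qed.

End Quotient.

(* Left-invariant, finitely additive probability measure on all subsets. *)
Definition invariant_mean (K : realType) (G : groupType) (mu : set G -> K) :=
  [/\ forall A, 0 <= mu A,
      mu setT = 1,
      forall A B, A `&` B = set0 -> mu (A `|` B) = mu A + mu B
    & forall g A, mu [set (g * x)%g | x in A] = mu A].

Definition amenable (K : realType) (G : groupType) : Prop :=
  exists mu : set G -> K, invariant_mean mu.

Definition residually_finite (G : groupType) : Prop :=
  forall g : G, g <> 1%g ->
    exists (H : finGroupType) (f : {multiplicative G -> H}), f g <> 1%g.

Definition hamming (K : realType) (n : nat) (p q : 'S_n) : K :=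
  #|[set i | p i != q i]%SET|%:R / n%:R.

(* The product of 'S_n composes from left to right, so fg_eval p is the
   homomorphism into Sym(n) for that convention. The other convention gives the
   same notions below, by passing from p i to its inverse: this exchanges the
   two products and preserves the Hamming distance. *)
Definition solution m (rels : set (free_group m)) n (p : 'I_m -> 'S_n) : Prop :=
  forall xi, rels xi -> fg_eval p xi = 1%g.

Definition strong_solution (K : realType) m (rels : set (free_group m))
    (delta : K) n (p : 'I_m -> 'S_n) : Prop :=
  forall xi : free_group m, (word_length xi)%:R < 1 / delta ->
    (normal_closure rels xi -> hamming K (fg_eval p xi) 1%g < delta) /\
    (~ normal_closure rels xi -> hamming K (fg_eval p xi) 1%g > 1 - delta).

Definition weakly_stable (K : realType) m (rels : set (free_group m)) : Prop :=
  forall eps : K, 0 < eps -> exists2 delta : K, 0 < delta &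
    forall (n : nat) (p : 'I_m -> 'S_n), (1 <= n)%N ->
      strong_solution rels delta p ->
      exists2 q : 'I_m -> 'S_n, solution rels q &
        forall i, hamming K (p i) (q i) < eps.

(* Main.v *)
(* Both directions rest on Folner sets, obtained from the invariant mean: if
   none existed, a finite set [W] would satisfy [2|F| <= |F W|] for all
   finite [F], and Hall's theorem (for infinite families) would give two
   injections of [G] with disjoint ranges, each a piecewise translation, so
   both ranges would have mean 1.

   If [rels] is weakly stable, a Folner set carries permutations that almost
   translate by the generators; a nearby exact solution is a homomorphism
   from [G] to a finite symmetric group that does not kill a prescribed
   element.

   Conversely, let [p] be a strong solution on [n] points. If [n] is small
   compared to [1/delta], [p] is exact. Otherwise [p] is compared with
   copies of a finite quotient of [G], padded with fixed points: any two
   good approximate actions of an amenable group on [n] points are almost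
   conjugate. This is an Ornstein-Weiss quasi-tiling run on both sides at
   once: pairs of translates [(xF, yF)] of one Folner set [F] are matched
   greedily as long as both tiles are almost disjoint from what is already
   covered; a maximal such family covers a proportion [eps] of what was
   left, and one repeats with Folner sets of decreasing size, each larger
   one being almost invariant under the smaller ones. *)
From HB Require Import structures.
Require Import Defs.
From mathcomp Require Import all_boot all_order all_algebra all_fingroup.
From mathcomp Require Import finmap zify ring lra generic_quotient.
From mathcomp Require Import all_classical all_reals.

Set Implicit Arguments.
Unset Strict Implicit.
Unset Printing Implicit Defensive.

Import Order.TTheory GRing.Theory Num.Theory.

(** * Hall's theorem for infinite families of finite sets *)

Section Hall.
Local Open Scope fset_scope.
Variables (I T : choiceType).
Implicit Types (A B : I -> {fset T}) (J : {fset I}).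

Definition hall_condition A :=
  forall J, (#|` J| <= #|` \bigcup_(i <- J) A i|)%N.

Lemma bigfcup_mono A B J : (forall i, i \in J -> A i `<=` B i) ->
  \bigcup_(i <- J) A i `<=` \bigcup_(i <- J) B i.
Proof.
move=> AB; apply/bigfcupsP => i iJ _.
apply: fsubset_trans (AB i iJ) _; exact: (@bigfcup_sup _ _ _ i).
Qed.

(** At each index the smallest finite set occurring in the chain lies in all the others, and these
    sets form the limit. For a finite [J], the member of least total size on [J] attains the limit
    at every index of [J], so Hall's inequality passes to the limit. *)
Lemma hall_condition_chain A (C : set (I -> {fset T})) :
  (exists B, C B) -> (forall B, C B -> hall_condition B) ->
  (forall B B', C B -> C B' ->
     (forall i, B i `<=` B' i) \/ (forall i, B' i `<=` B i)) ->
  exists2 L, hall_condition L & forall B, C B -> forall i, L i `<=` B i.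
Proof.
move=> [B0 CB0] hC totC.
have minC (w : (I -> {fset T}) -> nat) :
    exists2 B, C B & forall B', C B' -> (w B <= w B')%N.
  have ex : exists n, `[< exists2 B, C B & w B = n >].
    by exists (w B0); apply/asboolP; exists B0.
  case: (ex_minnP ex) => n /asboolP[B CB <-] min.
  by exists B => // B' CB'; apply: min; apply/asboolP; exists B'.
have /choice[m mP] : forall i, exists B, C B /\
    forall B', C B' -> (#|` B i| <= #|` B' i|)%N.
  by move=> i; have [B ? ?] := minC (fun B => #|` B i|); exists B.
have Lsub B i : C B -> m i i `<=` B i.
  move=> CB; have [Cm min] := mP i.
  have [//|Bm] := totC _ _ Cm CB.
  suff -> : B i = m i i by [].
  by apply/eqP; rewrite eqEfcard Bm min.
exists (fun i => m i i) => [J|B CB i]; last exact: Lsub.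
have [B CB min] := minC (fun B => \sum_(i <- J) #|` B i|)%N.
apply: leq_trans (hC _ CB J) _; apply/fsubset_leq_card/bigfcup_mono => i iJ.
have [Cm _] := mP i; have [//|mB] := totC _ _ CB Cm.
suff /eqP -> : B i == m i i by [].
rewrite eq_sym eqEfcard mB /=.
have := min _ Cm; rewrite (big_fsetD1 i) //= [leqRHS](big_fsetD1 i) //=.
have : (\sum_(j <- J `\ i) #|` m i j| <= \sum_(j <- J `\ i) #|` B j|)%N.
  by apply: leq_sum => j _; apply: fsubset_leq_card.
lia.
Qed.

(* Rado's submodularity argument: if two points [x], [y] could not be deleted
   from [B i], the two critical sets would violate Hall's condition. *)
Lemma hall_minimal_singleton B i : hall_condition B ->
  (forall B', hall_condition B' -> (forall j, B' j `<=` B j) -> B' = B) ->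
  exists x, B i = [fset x].
Proof.
move=> hB minB; apply/cardfs1P; rewrite eqn_leq; apply/andP; split; last first.
  by have := hB [fset i]; rewrite cardfs1 big_seq_fset1.
rewrite leqNgt; apply/negP => card2.
have [x xB] : exists x, x \in B i by apply/fset0Pn; rewrite -cardfs_gt0; lia.
have [y /fsetD1P[yx yB]] : exists y, y \in B i `\ x.
  by apply/fset0Pn; rewrite -cardfs_gt0; move: card2; rewrite (cardfsD1 x) xB.
pose D z j := if j == i then B i `\ z else B j.
(* By minimality, deleting [z] from [B i] breaks Hall's inequality for some set of indices; that set
   contains [i], and removing [i] from it gives [J]. *)
have crit z : z \in B i -> exists J, i \notin J /\
    (#|` \bigcup_(j <- J) B j `|` (B i `\ z)| <= #|` J|)%N.
  move=> zB; apply: contrapT => nJ.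
  suff /(congr1 (fun f => z \in f i)) : D z = B.
    by rewrite /D eqxx zB !inE eqxx.
  apply: minB => [J|j]; last first.
    by rewrite /D; case: eqP => // ->; apply: fsubD1set.
  rewrite leqNgt; apply/negP => lt.
  have eqD (K : {fset I}) : i \notin K ->
      \bigcup_(j <- K) D z j = \bigcup_(j <- K) B j.
    move=> iK; apply: eq_big_seq => j jK; rewrite /D; case: eqP => // ji.
    by rewrite -ji jK in iK.
  have [iJ|iJ] := boolP (i \in J); last first.
    by move: lt; rewrite ltnNge (eqD _ iJ) (hB J).
  apply: nJ; exists (J `\ i); split; first by rewrite !inE eqxx.
  move: lt; rewrite (big_fsetD1 i) //= {1}/D eqxx eqD ?inE ?eqxx // fsetUC.
  by rewrite (cardfsD1 i J) iJ; lia.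
have [J1 [iJ1 c1]] := crit _ xB; have [J2 [iJ2 c2]] := crit _ yB.
move: c1 c2; set U1 := _ `|` _ => c1; set U2 := _ `|` _ => c2.
have sup1 j : j \in J1 -> B j `<=` U1.
  by move=> jJ; apply: fsubset_trans (fsubsetUl _ _); apply: bigfcup_sup.
have sup2 j : j \in J2 -> B j `<=` U2.
  by move=> jJ; apply: fsubset_trans (fsubsetUl _ _); apply: bigfcup_sup.
(* Since [x] and [y] differ, [B i] lies in the union of [U1] and [U2]. This union therefore has at
   least one point more than [J1] and [J2] together have indices, and inclusion-exclusion
   contradicts [c1] and [c2]. *)
have cU : (#|` i |` (J1 `|` J2)| <= #|` U1 `|` U2|)%N.
  apply: leq_trans (hB _) _; apply/fsubset_leq_card/bigfcupsP => j + _.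
  case/fsetUP=> [/fset1P->|/fsetUP[jJ|jJ]].
  - apply/fsubsetP => z zj; rewrite !inE zj; have [zx|//] := eqVneq z x.
      by rewrite zx eq_sym yx !orbT.
    by rewrite orbT.
  - exact: fsubset_trans (sup1 _ jJ) (fsubsetUl _ _).
  - exact: fsubset_trans (sup2 _ jJ) (fsubsetUr _ _).
have cI : (#|` J1 `&` J2| <= #|` U1 `&` U2|)%N.
  apply: leq_trans (hB _) _; apply/fsubset_leq_card/bigfcupsP => j + _.
  by rewrite inE fsubsetI => /andP[j1 j2]; rewrite sup1 ?sup2.
have := cardfsUI U1 U2; have := cardfsUI J1 J2.
move: cU; rewrite cardfsU1 !inE negb_or iJ1 iJ2 /=; lia.
Qed.

(** Zorn's lemma, for reversed inclusion, gives a minimal Hall family inside [A]. Its sets are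
    singletons, and Hall's inequality on two indices makes the resulting choice injective. *)
Theorem hall_rado A : hall_condition A ->
  exists2 f : I -> T, injective f & forall i, f i \in A i.
Proof.
move=> hA.
pose S := {B | hall_condition B /\ forall i, B i `<=` A i}.
pose R (b b' : S) := `[< forall i, sval b' i `<=` sval b i >].
have [||||B maxB] := @Zorn S R.
- by move=> B; apply/asboolP => i.
- move=> B1 B2 B3 /asboolP h12 /asboolP h23; apply/asboolP => i.
  exact: fsubset_trans (h23 i) (h12 i).
- move=> [B1 p1] [B2 p2] /asboolP /= h12 /asboolP /= h21.
  apply: eq_exist => /=; apply: funext => i.
  by apply/eqP; rewrite eqEfsubset h12 h21.
- move=> C totC; have [[B0 CB0]|C0] := pselect (exists b : S, C b); last first.
    by exists (exist _ A (conj hA (fun i => fsubset_refl _))) => B CB;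
      case: C0; exists B.
  have [||| L hL LC] := @hall_condition_chain A [set L | exists2 b : S, C b &
    sval b = L]%classic.
  + by exists (sval B0), B0.
  + by move=> _ [B _ <-]; case: (svalP B).
  + move=> _ _ [B CB <-] [B' CB' <-].
    by case: (totC _ _ CB CB') => /asboolP; [right|left].
  have LA i : L i `<=` A i.
    apply: fsubset_trans (LC _ _ i) _; first by exists B0.
    by case: (svalP B0).
  exists (exist _ L (conj hL LA)) => B CB; apply/asboolP => i /=.
  by apply: LC; exists B.
case: B maxB => B [hB BA] maxB.
have /choice[f fB] : forall i, exists x, B i = [fset x].
  move=> i; apply: hall_minimal_singleton => // B' hB' B'B.
  have B'A j : B' j `<=` A j by apply: fsubset_trans (BA j).
  have RB' : R (exist _ B (conj hB BA)) (exist _ B' (conj hB' B'A)).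
    exact/asboolP.
  exact: (congr1 sval (maxB _ RB')).
exists f => [i j fij|i]; last first.
  by apply: (fsubsetP (BA i)); rewrite fB !inE.
apply/eqP; apply: contraT => ij.
have := hB [fset i; j]; rewrite cardfs2 ij big_fsetU1 ?inE //= big_seq_fset1.
by rewrite !fB fij fsetUid cardfs1.
Qed.

End Hall.

(** * Folner sets *)

Section Folner.
Local Open Scope fset_scope.
Local Open Scope ring_scope.
Variable K : realType.

Definition right_invariant_mean (G : groupType) (nu : set G -> K) :=
  [/\ forall A, 0 <= nu A,
      nu setT = 1,
      forall A B, (A `&` B = set0)%classic -> nu (A `|` B)%classic = nu A + nu B
    & forall g A, nu [set (x * g)%g | x in A]%classic = nu A].

(** Inversion exchanges left and right translations. The right-handed version fits permutations
    composed from left to right. *)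
Lemma amenable_right_mean (G : groupType) : amenable K G ->
  exists nu : set G -> K, right_invariant_mean nu.
Proof.
move=> [mu [mu0 muT muU muM]].
exists (fun A => mu [set g | A g^-1%g]%classic); split => //.
- move=> A B AB; rewrite -muU //; apply/seteqP; split => // g [Ag Bg].
  have : (A `&` B)%classic g^-1%g by [].
  by rewrite AB.
- move=> g A; rewrite -[RHS](muM g^-1%g); congr mu; apply/seteqP; split => h /=.
    move=> [x Ax xg]; exists (x^-1)%g; rewrite ?invgK //.
    by apply: invg_inj; rewrite invgM !invgK.
  by move=> [x Ax <-]; exists (x^-1)%g => //; rewrite invgM invgK.
Qed.

Section RightMean.
Variables (G : groupType) (nu : set G -> K).
Hypothesis nuP : right_invariant_mean nu.

Lemma mean_set0 : nu set0 = 0.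
Proof.
have [_ _ nuU _] := nuP; have := nuU set0 set0.
by rewrite setI0 setU0 => /(_ erefl) /eqP;
  rewrite addrC -subr_eq subrr eq_sym => /eqP.
Qed.

Lemma mean_le1 A : nu A <= 1.
Proof.
have [nu0 nuT nuU _] := nuP.
by rewrite -nuT -(setUCr A) nuU ?setICr // lerDl.
Qed.

Lemma mean_bigU (I : eqType) (r : seq I) (A : I -> set G) : uniq r ->
  (forall i j x, i \in r -> j \in r -> A i x -> A j x -> i = j) ->
  nu [set x | exists2 i, i \in r & A i x]%classic = \sum_(i <- r) nu (A i).
Proof.
have [_ _ nuU _] := nuP.
elim: r => [|i r IH] /= => [_ _|/andP[ir ur] dA].
  rewrite big_nil -mean_set0; congr nu; apply/seteqP; split => // x [].
  by move=> ?; rewrite in_nil.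
rewrite big_cons -IH //; last first.
  by move=> j k x jr kr; apply: dA; rewrite inE ?jr ?kr orbT.
rewrite -nuU.
  congr nu; apply/seteqP; split => x /=.
    by move=> [j /predU1P[->|jr] Ajx]; [left | right; exists j].
  by move=> [Aix|[j jr Ajx]]; [exists i | exists j];
    rewrite ?inE ?eqxx ?jr ?orbT.
apply/seteqP; split => // x [Aix [j jr Ajx]].
by move: ir; rewrite (dA i j x) ?jr // inE ?eqxx ?jr ?orbT.
Qed.

(** Cut [G] according to the finitely many values [w] of [g^-1 * f g]. The pieces partition [G];
    their translates by [w] are disjoint because [f] is injective, and they partition its range. *)
Lemma mean_piecewise_translation (W : {fset G}) (f : G -> G) :
  injective f -> (forall g, g^-1 * f g \in W)%g -> nu (range f) = 1.
Proof.
have [_ nuT _ nuM] := nuP; move=> injf fW.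
pose B w : set G := [set g | (g^-1 * f g)%g = w]%classic.
have fE g : f g = (g * (g^-1 * f g))%g by rewrite mulVKg.
rewrite -nuT; transitivity (\sum_(w <- W) nu [set (x * w)%g | x in B
  w]%classic).
  rewrite -mean_bigU ?fset_uniq //; last first.
    by move=> w w' x _ _ [g <- <-] [h <-]; rewrite -!fE => /injf ->.
  congr nu; apply/seteqP; split => x /=.
    by move=> [g _ <-]; exists (g^-1 * f g)%g => //; exists g => //;
      rewrite mulVKg.
  by move=> [w _ [g <-]]; rewrite -fE => <-; exists g.
under eq_bigr do rewrite nuM.
rewrite -mean_bigU ?fset_uniq //; last by move=> w w' x _ _ <- <-.
by congr nu; apply/seteqP; split => x //= _; exists (x^-1 * f x)%g.
Qed.

End RightMean.

Definition mulfs (G : groupType) (A B : {fset G}) : {fset G} :=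
  [fset (a * b)%g | a in A, b in B].

Lemma mulfsP (G : groupType) (A B : {fset G}) x :
  reflect (exists a b, [/\ a \in A, b \in B & x = a * b]%g) (x \in mulfs A B).
Proof.
apply: (iffP (imfset2P _ _ _ _ _)) => [[a aA [b bB ->]]|[a [b [aA bB ->]]]].
  by exists a, b.
by exists a => //; exists b.
Qed.

Lemma mulfsA (G : groupType) (A B C : {fset G}) :
  mulfs A (mulfs B C) = mulfs (mulfs A B) C.
Proof.
apply/fsetP => x; apply/mulfsP/mulfsP.
  move=> [a [_ [aA /mulfsP[b [c [bB cC ->]]] ->]]]; exists (a * b)%g, c.
  by split; rewrite ?mulgA //; apply/mulfsP; exists a, b.
move=> [_ [c [/mulfsP[a [b [aA bB ->]]] cC ->]]]; exists a, (b * c)%g.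
by split; rewrite ?mulgA //; apply/mulfsP; exists b, c.
Qed.

(** The boolean asks for two elements of each translate [gW]. A finite set [J] of pairs is at most
    twice as large as its projection [P], so doubling gives Hall's condition. *)
Lemma not_amenable_of_doubling (G : groupType) (W : {fset G}) :
  (forall F, 2 * #|` F| <= #|` mulfs F W|)%N -> ~ amenable K G.
Proof.
move=> dbl /amenable_right_mean[nu nuP].
pose A (x : G * bool) := mulfs [fset x.1] W.
have [J|f injf fA] := @hall_rado _ _ A.
  pose P := [fset x.1 | x in J].
  have sJ : J `<=` [fset (g, true) | g in P] `|` [fset (g, false) | g in P].
    apply/fsubsetP => -[g b] gJ; rewrite inE.
    have gP : g \in P by apply/imfsetP; exists (g, b).
    by apply/orP; case: b {gJ} ; [left|right]; apply/imfsetP; exists g.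
  have cJ : (#|` J| <= 2 * #|` P|)%N.
    apply: leq_trans (fsubset_leq_card sJ) _.
    apply: leq_trans (leq_card_fsetU _ _) _.
    by rewrite mul2n -addnn leq_add // leq_imfset_card.
  apply: leq_trans cJ (leq_trans (dbl P) _); apply: fsubset_leq_card.
  apply/fsubsetP => _ /mulfsP[_ [w [/imfsetP[x /= xJ ->] wW ->]]].
  apply/bigfcupP; exists x; rewrite ?xJ //; apply/mulfsP.
  by exists x.1, w; rewrite inE eqxx.
have fW b g : (g^-1 * f (g, b) \in W)%g.
  have /mulfsP[h [w [/fset1P -> wW ->]]] := fA (g, b).
  by rewrite mulKg.
have nu1 b : nu (range (fun g => f (g, b))) = 1.
  by apply: (mean_piecewise_translation nuP) (fW b) => g h /injf[].
have [_ _ nuU _] := nuP.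
have := mean_le1 nuP (range (fun g => f (g, true)) `|` range (fun g => f (g,
  false)))%classic.
rewrite nuU ?nu1; last first.
  by apply/seteqP; split => // x [[g _ <-] [h _ /injf]].
lra.
Qed.

Definition right_folner (G : groupType) (S : seq G) (eps : K) (F : {fset G}) :=
  F != fset0 /\ forall s, s \in S ->
    (count (fun g : G => (g * s)%g \notin F) F)%:R <= eps * #|` F|%:R.

(** Without a Folner set, multiplying by [T], which is [S] together with 1, enlarges every finite
    set by the factor [1 + eps], so a power of [T] doubles every finite set. *)
Theorem amenable_folner (G : groupType) (S : seq G) (eps : K) :
  amenable K G -> 0 < eps -> exists F, right_folner S eps F.
Proof.
move=> amG eps0; apply: contrapT => nF.
pose T : {fset G} := 1%g |` [fset s in S].
have grow (F : {fset G}) : (1 + eps) * #|` F|%:R <= #|` mulfs F T|%:R :> K.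
  have [->|F0] := eqVneq F fset0; first by rewrite cardfs0 mulr0.
  have [s sS sF] : exists2 s, s \in S &
      eps * #|` F|%:R < (count (fun g : G => (g * s)%g \notin F) F)%:R :> K.
    apply: contrapT => ns; apply: nF; exists F; split => // s sS.
    by rewrite leNgt; apply/negP => lt; apply: ns; exists s.
  have inj : injective (fun g : G => (g * s)%g) by move=> x y /mulIg.
  pose E := [fset (g * s)%g | g in F & (g * s)%g \notin F].
  have cE : #|` E| = count (fun g : G => (g * s)%g \notin F) F.
    by rewrite card_imfset //= -size_filter.
  have dFE : F `&` E = fset0.
    apply/fsetP => x; rewrite !inE; apply/negP => /andP[xF /imfsetP[g /=]].
    by rewrite !inE => /andP[_ gs] xE; rewrite xE (negbTE gs) in xF.
  have sFE : F `|` E `<=` mulfs F T.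
    apply/fsubsetP => x /fsetUP[xF|/imfsetP[g /=]].
      by apply/mulfsP; exists x, 1%g; rewrite mulg1 !inE eqxx.
    rewrite !inE => /andP[gF _] ->; apply/mulfsP; exists g, s.
    by rewrite !inE sS orbT.
  have := fsubset_leq_card sFE; rewrite cardfsU dFE cardfs0 subn0 cE.
  rewrite -(ler_nat K) natrD; lra.
have [n n1] : exists n : nat, 1 <= n%:R * eps.
  exists (Num.bound eps^-1); rewrite -ler_pdivrMr // div1r ltW //.
  by rewrite archi_boundP // invr_ge0 ltW.
(* Bernoulli's linear lower bound for the power of [1 + eps] suffices, as [n] was taken with
   [n * eps >= 1]. *)
suff [W WP] : exists W : {fset G}, forall F : {fset G},
    (1 + n%:R * eps) * #|` F|%:R <= #|` mulfs F W|%:R :> K.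
  apply: (not_amenable_of_doubling _ amG) => F.
  rewrite -(ler_nat K) natrM; apply: le_trans (WP F); rewrite ler_wpM2r //.
  lra.
elim: n {n1} => [|n [W WP]].
  exists [fset 1%g] => F; rewrite mul0r addr0 mul1r ler_nat.
  apply/fsubset_leq_card/fsubsetP => x xF; apply/mulfsP; exists x, 1%g.
  by rewrite inE mulg1.
exists (mulfs W T) => F; rewrite mulfsA; apply: le_trans (grow _).
have := WP F; have : 0 <= n%:R :> K by []; have : 0 <= #|` F|%:R :> K by [].
rewrite -natr1; move: (n%:R) (#|` F|%:R) => x c c0 x0 le.
have : (1 + eps) * ((1 + x * eps) * c) <= (1 + eps) * #|` mulfs F W|%:R.
  by rewrite ler_pM2l //; lra.
have : 0 <= x * eps * eps * c by rewrite !mulr_ge0 // ltW.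
lra.
Qed.

End Folner.

(** * Tiles *)

Section Tiling.
Local Open Scope ring_scope.

Definition matching (X Y : finType) (P : {set X * Y}) :=
  (forall x y y', (x, y) \in P -> (x, y') \in P -> y = y') /\
  (forall x x' y, (x, y) \in P -> (x', y) \in P -> x = x').

(** The complements of the domain and of the range of [P] have equal size, so their enumerations are
    paired off in order. *)
Lemma matching_extend (X Y : finType) (P : {set X * Y}) :
  #|X| = #|Y| -> matching P ->
  exists2 f : X -> Y, injective f & forall x y, (x, y) \in P -> f x = y.
Proof.
move=> cXY [Pf Pi].
pose D := [set z.1 | z in P]; pose E := [set z.2 | z in P].
have fst_inj : {in P &, injective (fun z : X * Y => z.1)}.
  by move=> [x y] [x' y'] /= xP x'P xx; rewrite xx in xP *;
    rewrite (Pf _ _ _ xP x'P).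
have snd_inj : {in P &, injective (fun z : X * Y => z.2)}.
  by move=> [x y] [x' y'] /= xP x'P yy; rewrite yy in xP *;
    rewrite (Pi _ _ _ xP x'P).
have cC : size (enum (~: D)) = size (enum (~: E)).
  rewrite -!cardE; have := cardsC D; have := cardsC E.
  by rewrite /D /E !card_in_imset // cXY => <- /addnI.
have nthE d x : x \notin D ->
    nth d (enum (~: E)) (index x (enum (~: D))) \in ~: E.
  by move=> xD; rewrite -mem_enum mem_nth // -cC index_mem mem_enum inE.
(* [Y] may be empty, so no default for [nth] is at hand. The value is characterized for every
   default instead, the index being in range. *)
have fP x : exists y, [/\ forall z, (x, z) \in P -> y = z, (x \in D -> y \in E)
    & (x \notin D -> forall d, y = nth d (enum (~: E)) (index x (enum (~:
      D))))].
  have [/imsetP[[x' y] xyP /= ->]|xD] := boolP (x \in D).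
    exists y; split => // [z|_]; first exact: Pf xyP.
    by apply/imsetP; exists (x', y).
  have ix : (index x (enum (~: D)) < size (enum (~: E)))%N.
    by rewrite -cC index_mem mem_enum inE.
  case eC : (enum (~: E)) ix => [//|d s] ix.
  exists (nth d (enum (~: E)) (index x (enum (~: D)))); split => //.
    by move=> z xz; case/negP: xD; apply/imsetP; exists (x, z).
  by move=> _ d'; rewrite eC; apply: set_nth_default.
have [f ff] := choice fP; exists f; last by move=> x y; have [+ _ _] := ff x;
  apply.
have inD x : x \in D -> (x, f x) \in P.
  by case/imsetP => [[x' y] xyP /= ->]; have [/(_ _ xyP) -> _ _] := ff x'.
have fDE x : (f x \in E) = (x \in D).
  apply/idP/idP => [|xD]; last by have [_ ->] := ff x.
  apply: contraLR => xD; have [_ _ /(_ xD (f x)) ->] := ff x.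
  by have := nthE (f x) _ xD; rewrite inE.
move=> x x' fxx; have [xD|xD] := boolP (x \in D).
  have x'D : x' \in D by rewrite -fDE -fxx fDE.
  by apply: Pi (inD _ xD) _; rewrite fxx; apply: inD.
have x'D : x' \notin D by rewrite -fDE -fxx fDE.
have [_ _ /(_ xD (f x)) e1] := ff x; have [_ _ /(_ x'D (f x)) e2] := ff x'.
have := fxx; rewrite e1 e2 => /eqP; rewrite nth_uniq ?enum_uniq //;
  last 2 first.
- by rewrite -cC index_mem mem_enum inE.
- by rewrite -cC index_mem mem_enum inE.
move=> /eqP ii; rewrite -(@nth_index _ x x (enum (~: D))) ?mem_enum ?inE // ii.
by rewrite nth_index // mem_enum inE.
Qed.

(** At these points [a] looks like a free action as far as [Q] can tell. The order of the factors is
    that of a right action. *)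
Definition good_points (G : groupType) (X : finType) (Q : seq G)
    (a : G -> X -> X) : {set X} :=
  [set x | all (fun g => all (fun h =>
     (a h (a g x) == a (g * h)%g x) && ((g == h) || (a g x != a h x))) Q) Q].

Section Tile.
Variables (G : groupType) (X : finType) (a : G -> X -> X).
Hypothesis inj_a : forall g, injective (a g).
Implicit Types (F : {fset G}) (A : {set X}) (Q : seq G).

Lemma good_mul Q x g h : x \in good_points Q a -> g \in Q -> h \in Q ->
  a h (a g x) = a (g * h)%g x.
Proof. by rewrite inE => /allP + gQ => /(_ _ gQ)/allP + hQ => /(_ _
  hQ)/andP[/eqP]. Qed.

Lemma good_inj Q x : x \in good_points Q a -> {in Q &, injective (a^~ x)}.
Proof.
rewrite inE => /allP + g h gQ => /(_ _ gQ)/allP + hQ /eqP => /(_ _ hQ)/andP[_].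
by case: eqP => //= _ /negbTE ->.
Qed.

Definition tile F x : {set X} := [set z in [seq a g x | g <- F]].

Lemma in_tile F x g : g \in F -> a g x \in tile F x.
Proof. by move=> gF; rewrite inE; apply: map_f. Qed.

Lemma card_tile_count Q F x (p : pred X) :
  x \in good_points Q a -> {subset F <= Q} ->
  #|[set z in tile F x | p z]| = count (fun g => p (a g x)) F.
Proof.
move=> gx FQ; rewrite -size_filter.
have u : uniq [seq a g x | g <- [seq g <- F | p (a g x)]].
  rewrite map_inj_in_uniq ?filter_uniq ?fset_uniq // => g h.
  rewrite !mem_filter => /andP[_ gF] /andP[_ hF].
  by apply: good_inj gx _ _ _ _; apply: FQ.
rewrite -(size_map (a^~ x)) -(card_uniqP u); apply: eq_card => z.
rewrite !inE; apply/andP/mapP.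
  by move=> [/mapP[g gF ->] pg]; exists g; rewrite // mem_filter pg.
by move=> [g]; rewrite mem_filter => /andP[pg gF] ->; split=> //; apply: map_f.
Qed.

Definition boundary g A : {set X} := [set x in A | a g x \notin A].

Lemma boundaryU g A B :
  (#|boundary g (A :|: B)| <= #|boundary g A| + #|boundary g B|)%N.
Proof.
apply: leq_trans (leq_card_setU _ _); apply: subset_leq_card.
by apply/fintype.subsetP => x; rewrite !inE negb_or; case: (x \in A);
  case: (x \in B);
  case: (a g x \in A); case: (a g x \in B).
Qed.

Lemma boundary_tile Q F x k : x \in good_points Q a -> {subset F <= Q} -> k \in
  Q ->
  (#|boundary k (tile F x)| <= count (fun g : G => (g * k)%g \notin F) F)%N.
Proof.
move=> gx FQ kQ; rewrite (card_tile_count (fun z => a k z \notin tile F x) gx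
  FQ).
rewrite -!size_filter; apply: uniq_leq_size;
  first by rewrite filter_uniq ?fset_uniq.
move=> g; rewrite !mem_filter => /andP[+ gF]; rewrite gF andbT;
  apply: contra => gk.
by rewrite (good_mul gx (FQ _ gF) kQ) in_tile.
Qed.

(** On a finite set an injective map brings as many points into [A] as it takes out of it. *)
Lemma card_boundaryV g A :
  #|[set x in ~: A | a g x \in A]| = #|boundary g A|.
Proof.
have := cardsID A (a g @^-1: A); have := cardsID (a g @^-1: A) A.
rewrite card_preimset // (finset.setIC A) => <- /addnI.
rewrite (_ : _ :\: A = [set x in ~: A | a g x \in A]); last first.
  by apply/setP => x; rewrite !inE.
by move=> ->; apply: eq_card => x; rewrite !inE andbC.
Qed.

(** Count in two ways the pairs of a good point [x] outside [A0] and an element [g] of [F] with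
    [a g x] in [A]. Each [x] has more than [e * |F|] partners. Each [g] has at most [tau] partners
    sent into [A0], and at most [|A \ A0|] sent to the rest of [A]. *)
Lemma tile_gain (K : realType) Q F A0 A (e tau : K) : F != fset0 ->
  0 <= e -> A0 \subset A ->
  (forall f, f \in F -> #|boundary f A0|%:R <= tau) ->
  (forall x, x \in good_points Q a ->
     e * #|` F|%:R < (count (fun g => a g x \in A) F)%:R) ->
  e * (#|X|%:R - #|A0|%:R - #|~: good_points Q a|%:R) <= tau + #|A :\: A0|%:R.
Proof.
move=> F0 e0 A0A bd full.
have Fpos : 0 < #|` F|%:R :> K by rewrite ltr0n cardfs_gt0.
rewrite -(ler_pM2l Fpos).
pose U := ~: A0 :&: good_points Q a.
have cU : #|X|%:R - #|A0|%:R - #|~: good_points Q a|%:R <= #|U|%:R :> K.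
  rewrite lerBlDr lerBlDl -!natrD ler_nat -(cardsC U) addnC.
  have -> : ~: U = A0 :|: ~: good_points Q a by rewrite finset.setCI
    finset.setCK.
  by rewrite addnC addnCA leq_add2l (leq_card_setU A0 _).1.
apply: (@le_trans _ _ (\sum_(x in U) (count (fun g => a g x \in A) F)%:R)).
  apply: (@le_trans _ _ (\sum_(x in U) e * #|` F|%:R)).
    rewrite sumr_const -[leRHS]mulr_natr [leLHS]mulrA [_ * e]mulrC ler_wpM2l //.
    by rewrite mulr_ge0.
  by apply: ler_sum => x; rewrite inE => /andP[_ gx]; apply/ltW/full.
have countE x : (count (fun g => a g x \in A) F)%:R
    = \sum_(g <- F) (a g x \in A)%:R :> K.
  by rewrite -sum1_count natr_sum [LHS]big_mkcond; apply: eq_bigr => g _;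
    case: (_ \in A).
under eq_bigr do rewrite countE.
rewrite exchange_big /=.
have -> : #|` F|%:R * (tau + #|A :\: A0|%:R) = \sum_(g <- F) (tau + #|A :\:
  A0|%:R) :> K.
  by rewrite big_const_seq count_predT iter_addr_0 mulr_natl.
rewrite big_seq [leRHS]big_seq; apply: ler_sum => g gF.
rewrite -natr_sum; apply: (@le_trans _ _ (#|boundary g A0| + #|A :\: A0|)%:R);
  last first.
  by rewrite natrD lerD2r bd.
rewrite ler_nat -card_boundaryV -(card_preimset (A :\: A0) (@inj_a g)).
rewrite -big_mkcondr /= sum1dep_card.
apply: leq_trans (leq_card_setU _ _); apply: subset_leq_card.
apply/fintype.subsetP => x; rewrite !inE; case: (x \in A0) => //=.
by case: (a g x \in A0); case: (a g x \in A); rewrite ?orbT ?andbT ?andbF.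
Qed.

End Tile.
End Tiling.

(** * Almost disjoint tiles, placed in two spaces at once *)

Section QuasiTiling.
Local Open Scope ring_scope.
Variables (K : realType) (G : groupType).

(* What is remembered of a union [A] of [e]-disjoint tiles of total size [M]. *)
Definition tiled_region (X : finType) (a : G -> X -> X) (T : seq G) (e t : K)
    (A : {set X}) (M : nat) : Prop :=
  [/\ (1 - e) * M%:R <= #|A|%:R, (#|A| <= M)%N &
      forall k, k \in T -> #|boundary a k A|%:R <= t * M%:R].

Definition tile_fits (X : finType) (a : G -> X -> X) (Q : seq G) (F : {fset G})
    (e : K) (A : {set X}) (x : X) : Prop :=
  x \in good_points Q a /\ (count (fun g => a g x \in A) F)%:R <= e * #|` F|%:R.

Lemma card_tile (X : finType) (a : G -> X -> X) Q (F : {fset G}) x :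
  x \in good_points Q a -> {subset F <= Q} -> #|tile a F x| = #|` F|.
Proof.
move=> gx FQ; have := card_tile_count xpredT gx FQ; rewrite count_predT => <-.
by apply: eq_card => z; rewrite !inE andbT.
Qed.

Lemma card_setI_tile (X : finType) (a : G -> X -> X) Q (F : {fset G}) A x :
  x \in good_points Q a -> {subset F <= Q} ->
  #|A :&: tile a F x| = count (fun g => a g x \in A) F.
Proof.
move=> gx FQ; rewrite -(card_tile_count _ gx FQ).
by apply: eq_card => z; rewrite !inE andbC.
Qed.

Lemma tiled_region_add (X : finType) (a : G -> X -> X) Q S T e t F A M x :
  tiled_region a T e t A M -> right_folner (S ++ T) t F ->
  {subset F <= Q} -> {subset T <= Q} -> tile_fits a Q F e A x ->
  tiled_region a T e t (A :|: tile a F x) (M + #|` F|).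
Proof.
move=> [lo up bd] [_ inv] FQ TQ [gx fit]; split.
- have := cardsUI A (tile a F x).
  rewrite (card_tile gx FQ) (card_setI_tile _ gx FQ).
  move=> /(congr1 (fun n => n%:R : K)); rewrite !natrD; lra.
- apply: leq_trans (leq_card_setU _ _) _.
  by rewrite (card_tile gx FQ) leq_add2r.
- move=> k kT; rewrite natrD mulrDr.
  apply: le_trans
    (_ : (#|boundary a k A| + #|boundary a k (tile a F x)|)%:R <= _).
    by rewrite ler_nat boundaryU.
  rewrite natrD lerD ?bd //; apply: le_trans (inv k _); last first.
    by rewrite mem_cat kT orbT.
  by rewrite ler_nat (boundary_tile gx) // TQ.
Qed.

Variables (X Y : finType) (a : G -> X -> X) (b : G -> Y -> Y).

Definition intertwined (P : {set X * Y}) (s : G) : {set X * Y} :=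
  [set z in P | (a s z.1, b s z.2) \in P].

(* A pair of tiles of size [k] loses at most [5 * e * k] points for each [s]: those
   with [g * s] outside the Folner set, and those for which [g] or [g * s] falls
   into [A] or [B]. *)
Definition tiling (S T : seq G) (e t : K) (A : {set X})
    (B : {set Y}) (P : {set X * Y}) (M : nat) : Prop :=
  [/\ matching P, {in P, forall z, z.1 \in A /\ z.2 \in B},
      tiled_region a T e t A M, tiled_region b T e t B M &
      forall s, s \in S -> (1 - 5 * e) * M%:R <= #|intertwined P s|%:R].

Lemma count_shift (F : {fset G}) (s : G) (p : pred G) :
  (count (fun g => ((g * s)%g \in F) && p (g * s)%g) F <= count p F)%N.
Proof.
rewrite -!size_filter -(size_map (fun g => g * s)%g); apply: uniq_leq_size.
  by rewrite map_inj_uniq ?filter_uniq ?fset_uniq // => g h /mulIg.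
by move=> _ /mapP[g + ->]; rewrite !mem_filter => /andP[/andP[-> ->]].
Qed.

(** The new pairs are [(a g x, b g y)] for those [g] in [F] at which neither point is covered
    already. As [x] and [y] are good, translation by [s] takes the pair of [g] to that of
    [g * s]. *)
Lemma tiling_add Q S T e t F A B P M x y : t <= e ->
  tiling S T e t A B P M -> right_folner (S ++ T) t F ->
  {subset F <= Q} -> {subset S <= Q} -> {subset T <= Q} ->
  tile_fits a Q F e A x -> tile_fits b Q F e B y ->
  exists P', tiling S T e t (A :|: tile a F x) (B :|: tile b F y) P'
    (M + #|` F|).
Proof.
move=> te [[Pf Pi] PAB tA tB Pint] inv FQ SQ TQ fx fy.
pose p g := (a g x \notin A) && (b g y \notin B).
pose N : {set X * Y} := [set z in [seq (a g x, b g y) | g <- F & p g]].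
have NP z : reflect (exists g, [/\ g \in F, p g & z = (a g x, b g y)])
    (z \in N).
  rewrite inE; apply: (iffP mapP) => [[g]|[g [gF pg ->]]].
    by rewrite mem_filter => /andP[pg gF] ->; exists g.
  by exists g; rewrite // mem_filter pg.
have [gx cx] := fx; have [gy cy] := fy.
have injx := good_inj gx; have injy := good_inj gy.
have disj z : z \in P -> z \in N -> False.
  by move=> /PAB[zA _] /NP[g [_ /andP[gA _] zE]];
    rewrite zE /= (negbTE gA) in zA.
exists (P :|: N); split.
- split=> [u v v'|u u' v]; rewrite !inE -![_ \in map _ _]inE -/N.
    move=> /orP[uv|/NP[g [gF /andP[ga gb] [ug vg]]]]
      /orP[uv'|/NP[h [hF /andP[ha hb] [uh vh]]]].
    + exact: Pf uv uv'.
    + by have [/= uA _] := PAB _ uv; rewrite uh (negbTE ha) in uA.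
    + by have [/= uA _] := PAB _ uv'; rewrite ug (negbTE ga) in uA.
    + by rewrite vg vh (injx g h) ?FQ // -ug -uh.
  move=> /orP[uv|/NP[g [gF /andP[ga gb] [ug vg]]]] /orP[uv'|/NP[h [hF /andP[ha
    hb] [uh vh]]]].
  + exact: Pi uv uv'.
  + by have [/= _ vB] := PAB _ uv; rewrite vh (negbTE hb) in vB.
  + by have [/= _ vB] := PAB _ uv'; rewrite vg (negbTE gb) in vB.
  + by rewrite ug uh (injy g h) ?FQ // -vg -vh.
- move=> z /setUP[/PAB[zA zB]|/NP[g [gF _ ->]]]; first by rewrite !inE zA zB.
  by split; rewrite /= finset.in_setU in_tile ?orbT.
- exact: tiled_region_add tA inv FQ TQ fx.
- exact: tiled_region_add tB inv FQ TQ fy.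
move=> s sS; have sST : s \in S ++ T by rewrite mem_cat sS.
have [_ /(_ s sST) invs] := inv.
pose q g := [&& p g, (g * s)%g \in F & p (g * s)%g].
(* An element [g] fails [q] because [g * s] leaves [F], or because one of the four points attached
   to [g] and [g * s] is covered. This costs [t * |F|] and four times [e * |F|], hence the factor
   [1 - 5 * e]. *)
have cq : (#|` F| <= count q F + count (fun g : G => (g * s)%g \notin F) F
    + (count (fun g => a g x \in A) F + count (fun g => b g y \in B) F
    + (count (fun g => a g x \in A) F + count (fun g => b g y \in B) F)))%N.
  apply: leq_trans (_ : (_ <= count q F + count (fun g : G => (g * s)%g \notin
    F) F
    + (count (fun g => a g x \in A) F + count (fun g => b g y \in B) F
    + (count (fun g => ((g * s)%g \in F) && (a (g * s)%g x \in A)) F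
      + count (fun g => ((g * s)%g \in F) && (b (g * s)%g y \in B)) F)))%N) _.
    elim: (enum_fset F) => //= g r IH.
    have pt : (1 <= q g + ((g * s)%g \notin F) + ((a g x \in A) + (b g y \in B)
        + (((g * s)%g \in F) && (a (g * s)%g x \in A)
          + ((g * s)%g \in F) && (b (g * s)%g y \in B))))%N.
      rewrite /q /p; case: (a g x \in A); case: (b g y \in B);
      case: ((g * s)%g \in F); case: (a (g * s)%g x \in A);
      by case: (b (g * s)%g y \in B).
    by apply: leq_trans (leq_add pt IH) _; apply/eq_leq; ring.
  by rewrite !leq_add2l leq_add // count_shift.
have cN : (#|intertwined P s| + count q F <= #|intertwined (P :|: N) s|)%N.
  have -> : count q F = #|[set z in [seq (a g x, b g y) | g <- F & q g]]|.
    rewrite cardsE -size_filter -(size_map (fun g => (a g x, b g y))).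
    apply/esym/card_uniqP; rewrite map_inj_in_uniq ?filter_uniq ?fset_uniq //.
    move=> g h; rewrite !mem_filter => /andP[_ gF] /andP[_ hF] [/injx E _].
    by apply: E; apply: FQ.
  rewrite -[leqLHS]subn0 -[X in (_ - X <= _)%N](_ : #|intertwined P s :&:
     [set z in [seq (a g x, b g y) | g <- F & q g]]| = 0); last first.
    apply: eq_card0 => z; apply/negP => /setIP[]; rewrite inE => /andP[zP _].
    rewrite inE => /mapP[g]; rewrite mem_filter => /andP[/and3P[pg _ _] gF] zg.
    by apply: disj zP _; apply/NP; exists g.
  rewrite -finset.cardsU; apply/subset_leq_card/fintype.subsetP => z.
  case/setUP; rewrite inE; first by case/andP => zP szP; rewrite !inE zP szP.
  case/mapP => g; rewrite mem_filter => /andP[/and3P[pg gsF pgs] gF] ->.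
  have sQ := SQ _ sS.
  rewrite inE !finset.in_setU /= (good_mul gx (FQ _ gF) sQ) (good_mul gy (FQ _
    gF) sQ).
  by apply/andP; split; apply/orP; right; apply/NP; [exists g|exists (g * s)%g].
have := Pint s sS; move: cq cN; rewrite -!(ler_nat K) !natrD.
have : t * #|` F|%:R <= e * #|` F|%:R by rewrite ler_wpM2r.
lra.
Qed.

End QuasiTiling.

(** * Quasi-tilings and almost conjugacy *)

Section OrnsteinWeiss.
Local Open Scope ring_scope.
Variables (K : realType) (G : groupType).

Section Stages.
Variables (X Y : finType) (a : G -> X -> X) (b : G -> Y -> Y).
Variables (Q S : seq G) (e t : K).
Hypotheses (inj_a : forall g, injective (a g)) (inj_b : forall g, injective (b
  g)).
Hypotheses (e0 : 0 < e) (e1 : 2 * e <= 1) (t0 : 0 < t) (te : t <= e).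
Hypothesis SQ : {subset S <= Q}.

Lemma tiled_region_sub (Z : finType) (c : G -> Z -> Z) T T' A M :
  {subset T' <= T} -> tiled_region c T e t A M -> tiled_region c T' e t A M.
Proof. by move=> T'T [lo up bd]; split=> // k /T'T/bd. Qed.

Lemma tiling_sub T T' A B P M : {subset T' <= T} ->
  tiling a b S T e t A B P M -> tiling a b S T' e t A B P M.
Proof. by move=> T'T [? ? ? ? ?]; split => //;
  apply: tiled_region_sub T'T _. Qed.

(** Pairs of fitting tiles are added one at a time. A fitting tile has at most half of its points in
    [A] because [2 * e <= 1], so [A] grows strictly and the process stops. *)
Lemma tiling_greedy T (F : {fset G}) A0 B0 P0 M0 :
  tiling a b S T e t A0 B0 P0 M0 -> right_folner (S ++ T) t F ->
  {subset F <= Q} -> {subset T <= Q} ->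
  exists (A : {set X}) (B : {set Y}) P M, [/\ tiling a b S T e t A B P M,
    A0 \subset A /\ (#|A :\: A0| + M0 <= M)%N,
    B0 \subset B /\ (#|B :\: B0| + M0 <= M)%N
    & (forall x, ~ tile_fits a Q F e A x) \/
      (forall y, ~ tile_fits b Q F e B y)].
Proof.
move=> tl0 fol FQ TQ.
have lt_tile A x : tile_fits a Q F e A x -> (#|A| < #|A :|: tile a F x|)%N.
  move=> [gx cx]; rewrite -(ltr_nat K).
  have := cardsUI A (tile a F x).
  rewrite (card_tile gx FQ) (card_setI_tile _ gx FQ).
  move=> /(congr1 (fun n => n%:R : K)); rewrite !natrD.
  have F0 : 0 < #|` F|%:R :> K by rewrite ltr0n cardfs_gt0; case: fol.
  have : 2 * e * #|` F|%:R <= 1 * #|` F|%:R by rewrite ler_pM2r.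
  lra.
suff main k (A : {set X}) (B : {set Y}) P M :
    (#|X| - #|A| < k)%N -> tiling a b S T e t A B P M ->
    A0 \subset A /\ (#|A :\: A0| + M0 <= M)%N ->
    B0 \subset B /\ (#|B :\: B0| + M0 <= M)%N ->
    exists (A : {set X}) (B : {set Y}) P M, [/\ tiling a b S T e t A B P M,
      A0 \subset A /\ (#|A :\: A0| + M0 <= M)%N,
      B0 \subset B /\ (#|B :\: B0| + M0 <= M)%N
      & (forall x, ~ tile_fits a Q F e A x) \/
        (forall y, ~ tile_fits b Q F e B y)].
  by apply: (main _ _ _ _ _ (ltnSn _) tl0); rewrite subxx finset.setDv cards0.
elim: k A B P M => [//|k IH] A B P M cA tl hA hB.
have [[x fx]|nx] := pselect (exists x, tile_fits a Q F e A x); last first.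
  by exists A, B, P, M; split => //; left => x fx; apply: nx; exists x.
have [[y fy]|ny] := pselect (exists y, tile_fits b Q F e B y); last first.
  by exists A, B, P, M; split => //; right => y fy; apply: ny; exists y.
have ltA := lt_tile _ _ fx.
have maxA : (#|A :|: tile a F x| <= #|X|)%N by apply: max_card.
have [P' tl'] := tiling_add te tl fol FQ SQ TQ fx fy.
have grow (Z : finType) (c : G -> Z -> Z) (C0 C : {set Z}) z :
    z \in good_points Q c -> C0 \subset C /\ (#|C :\: C0| + M0 <= M)%N ->
    C0 \subset C :|: tile c F z /\
    (#|(C :|: tile c F z) :\: C0| + M0 <= M + #|` F|)%N.
  move=> gz [sC cC]; split;
    first exact: fintype.subset_trans sC (finset.subsetUl _ _).
  rewrite finset.setDUl.
  have := (leq_card_setU (C :\: C0) (tile c F z :\: C0)).1.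
  have := subset_leq_card (finset.subsetDl (tile c F z) C0);
    rewrite (card_tile gz FQ).
  lia.
apply: (IH _ _ P' _ _ tl'); first by lia.
- by apply: grow => //; case: fx.
- by apply: grow => //; case: fy.
Qed.

Variable n : nat.
Hypotheses (cX : #|X| = n) (cY : #|Y| = n).
Hypotheses (good_a : #|~: good_points Q a|%:R <= t * n%:R)
  (good_b : #|~: good_points Q b|%:R <= t * n%:R).

(** This is [tile_gain] with [tau = t * M0]. Since [(1 - e) * M0 <= n] forces [M0 <= 2 * n], the
    boundary costs at most [2 * t * n], and the bad points at most [t * n]. *)
Lemma full_gain (Z : finType) (c : G -> Z -> Z) T (F : {fset G})
    (C0 C : {set Z}) M0 M :
  (forall g, injective (c g)) -> #|Z| = n ->
  #|~: good_points Q c|%:R <= t * n%:R ->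
  tiled_region c (F ++ T) e t C0 M0 -> F != fset0 ->
  C0 \subset C -> (#|C :\: C0| + M0 <= M)%N ->
  (forall x, ~ tile_fits c Q F e C x) ->
  n%:R - M%:R <= (1 - e) * (n%:R - M0%:R) + 3 * t * n%:R.
Proof.
move=> inj_c cZ gc [lo up bd] F0 sC cC full.
have ele1 : e <= 1 by move: e0 e1; lra.
have bdF f : f \in F -> #|boundary c f C0|%:R <= t * M0%:R :> K.
  by move=> fF; apply: bd; rewrite mem_cat fF.
have fullF x : x \in good_points Q c ->
    e * #|` F|%:R < (count (fun g => c g x \in C) F)%:R :> K.
  by move=> gx; rewrite ltNge; apply/negP => le; apply: (full x).
have := tile_gain inj_c F0 (ltW e0) sC bdF fullF.
rewrite cZ => gain.
have C0n : #|C0|%:R <= n%:R :> K by rewrite ler_nat -cZ max_card.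
have n0 : 0 <= n%:R :> K by [].
have M0n : M0%:R <= 2 * n%:R :> K.
  have : 2 * e * M0%:R <= 1 * M0%:R by rewrite ler_wpM2r.
  lra.
have tM : t * M0%:R <= t * (2 * n%:R) by rewrite ler_pM2l.
have up' : e * #|C0|%:R <= e * M0%:R by rewrite ler_pM2l // ler_nat.
have gc' : e * #|~: good_points Q c|%:R <= 1 * (t * n%:R).
  by apply: ler_pM; rewrite ?ler0n ?(ltW e0).
move: cC; rewrite -(ler_nat K) natrD; lra.
Qed.

(** Both sides share the total [M], so it is enough that one of them is full. The boundary bounds
    for [F] are spent here; those for [T] are kept for later stages. *)
Lemma tiling_stage T (F : {fset G}) A B P M :
  tiling a b S (F ++ T) e t A B P M -> right_folner (S ++ T) t F ->
  {subset F <= Q} -> {subset T <= Q} ->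
  exists A' B' P' M', tiling a b S T e t A' B' P' M' /\
    n%:R - M'%:R <= (1 - e) * (n%:R - M%:R) + 3 * t * n%:R.
Proof.
move=> tl fol FQ TQ.
have sT : {subset T <= F ++ T} by move=> g gT; rewrite mem_cat gT orbT.
have [A' [B' [P' [M' [tl' [sA cA] [sB cB] full]]]]] :=
  tiling_greedy (tiling_sub sT tl) fol FQ TQ.
exists A', B', P', M'; split=> //; have [_ _ tA tB _] := tl.
have F0 : F != fset0 by case: fol.
by case: full; [apply: full_gain inj_a cX good_a tA F0 sA cA
              | apply: full_gain inj_b cY good_b tB F0 sB cB].
Qed.

Definition flat (Fs : seq {fset G}) : seq G := flatten [seq enum_fset F | F <-
  Fs].

(** The sets are used from the head on, and each is almost invariant under those after it; a chain
    is therefore built from its last set backwards. *)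
Fixpoint folner_chain (Fs : seq {fset G}) : Prop :=
  if Fs is F :: Fs' then right_folner (S ++ flat Fs') t F /\ folner_chain Fs'
  else True.

(** The quantity [3 * t / e * n] is the fixed point of the recursion in [tiling_stage]; once it is
    subtracted, the uncovered amount decays geometrically. *)
Lemma tiling_chain Fs A B P M : folner_chain Fs -> {subset flat Fs <= Q} ->
  tiling a b S (flat Fs) e t A B P M ->
  exists A' B' P' M', tiling a b S [::] e t A' B' P' M' /\
    n%:R - M'%:R - 3 * t / e * n%:R
      <= (1 - e) ^+ size Fs * (n%:R - M%:R - 3 * t / e * n%:R).
Proof.
elim: Fs A B P M => [|F Fs IH] A B P M /=.
  by move=> _ _ tl; exists A, B, P, M; rewrite expr0 mul1r.
move=> [fol chain] FsQ tl.
have [||A1 [B1 [P1 [M1 [tl1 gain1]]]]] := tiling_stage tl fol.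
- by move=> g gF; apply: FsQ; rewrite mem_cat gF.
- by move=> g gF; apply: FsQ; rewrite mem_cat gF orbT.
have [|A' [B' [P' [M' [tl' gain']]]]] := IH _ _ _ _ chain _ tl1.
  by move=> g gF; apply: FsQ; rewrite mem_cat gF orbT.
exists A', B', P', M'; split => //; apply: le_trans gain' _.
rewrite exprSr -[leRHS]mulrA ler_wpM2l ?exprn_ge0 //.
  by move: e0 e1; lra.
suff -> : (1 - e) * (n%:R - M%:R - 3 * t / e * n%:R)
    = (1 - e) * (n%:R - M%:R) + 3 * t * n%:R - 3 * t / e * n%:R by lra.
by field; rewrite gt_eqF.
Qed.

End Stages.

Lemma folner_chain_ex (S : seq G) (t : K) k : amenable K G -> 0 < t ->
  exists2 Fs, size Fs = k & folner_chain S t Fs.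
Proof.
move=> am t0; elim: k => [|k [Fs <- ch]]; first by exists [::].
by have [F fol] := amenable_folner (S ++ flat Fs) am t0; exists (F :: Fs).
Qed.

Lemma geometric_small (e : K) : 0 < e -> e <= 1 -> exists k, (1 - e) ^+ k <= e.
Proof.
move=> e0 e1.
have bern k : (1 - e) ^+ k * (1 + k%:R * e) <= 1.
  elim: k => [|k IH]; first by rewrite expr0 mul0r addr0 mulr1.
  apply: le_trans IH; rewrite exprSr -mulrA ler_wpM2l ?exprn_ge0 //; first lra.
  rewrite -natr1; have : 0 <= k%:R * (e * e) by rewrite !mulr_ge0 // ltW.
  have : 0 < e * e by rewrite mulr_gt0.
  lra.
exists (Num.bound (e * e)^-1);
  move: (Num.bound _) (@archi_boundP K (e * e)^-1) => k kb.
have {}kb : 1 <= k%:R * e * e.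
  rewrite -mulrA -ler_pdivrMr ?mulr_gt0 // div1r ltW // kb // invr_ge0 ltW //.
  by rewrite mulr_gt0.
have := bern k; have : 0 <= (1 - e) ^+ k by rewrite exprn_ge0 //; lra.
move: ((1 - e) ^+ k) (k%:R * e) kb => x y kb x0 h.
rewrite leNgt; apply/negP => ex.
have : e * (1 + y) < x * (1 + y).
  rewrite ltr_pM2r //; have : 0 < y; last lra.
  by rewrite -(pmulr_lgt0 _ e0); lra.
lra.
Qed.

(** [Q] and [t] come from a Folner chain in [G] alone, so they serve all [X] and [Y] of any size.
    The matching produced by the tiling is extended to a bijection. *)
Theorem almost_conjugate (S : seq G) (eps : K) : amenable K G -> 0 < eps ->
  exists Q : seq G, exists2 t : K, 0 < t &
  forall (X Y : finType) (a : G -> X -> X) (b : G -> Y -> Y),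
    (forall g, injective (a g)) -> (forall g, injective (b g)) -> #|X| = #|Y| ->
    #|~: good_points Q a|%:R <= t * #|X|%:R ->
    #|~: good_points Q b|%:R <= t * #|X|%:R ->
    exists2 f : X -> Y, injective f &
      forall s, s \in S -> #|[set x | f (a s x) != b s (f x)]|%:R <= eps *
        #|X|%:R.
Proof.
move=> am eps0.
pose e := Num.min (1 / 7) (eps / 7).
have e0 : 0 < e by rewrite /e lt_min; apply/andP; split; lra.
have e1 : 7 * e <= 1.
  have : e <= 1 / 7 by rewrite /e ge_min lexx.
  lra.
have e2 : 7 * e <= eps.
  have : e <= eps / 7 by rewrite /e ge_min lexx orbT.
  lra.
have e1' : 2 * e <= 1 by lra.
(* This makes [3 * t / e] equal to [e]; together with [(1 - e) ^+ k <= e] it leaves at most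
   [2 * e * |X|] uncovered. *)
pose t := e * e / 3.
have ee : e * e <= 1 / 7 * e by rewrite ler_pM2r //; lra.
have t0 : 0 < t by rewrite divr_gt0 ?mulr_gt0.
have te : t <= e by rewrite /t; lra.
have tE : 3 * t / e = e by rewrite /t; field; rewrite gt_eqF.
have [k ke] : exists k, (1 - e) ^+ k <= e by apply: geometric_small => //; lra.
have [Fs sFs chain] := folner_chain_ex S k am t0.
exists (S ++ flat Fs), t => // X Y a b inj_a inj_b cXY good_a good_b.
have tl0 : tiling a b S (flat Fs) e t finset.set0 finset.set0 finset.set0 0.
  have tr0 (Z : finType) (c : G -> Z -> Z) :
      tiled_region c (flat Fs) e t finset.set0 0.
    split; rewrite ?cards0 ?mulr0 // => g _.
    have -> : boundary c g finset.set0 = finset.set0.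
      by apply/setP => z; rewrite !inE.
    by rewrite cards0.
  split => //; first by split=> [x y y'|x x' y]; rewrite inE.
    by move=> z; rewrite inE.
  by move=> s _; rewrite mulr0.
have [||A [B [P [M [tl gain]]]]] :=
  tiling_chain inj_a inj_b e0 e1' t0 te _ erefl (esym cXY) good_a good_b chain
    _ tl0.
- by move=> g gS; rewrite mem_cat gS.
- by move=> g gS; rewrite mem_cat gS orbT.
move: gain; rewrite tE subr0 sFs.
have X0 : 0 <= #|X|%:R :> K by [].
have q0 : 0 <= (1 - e) ^+ k by rewrite exprn_ge0 //; lra.
have : (1 - e) ^+ k * (#|X|%:R - e * #|X|%:R) <= e * #|X|%:R.
  apply: ler_pM => //; last first.
    by have := mulr_ge0 (ltW e0) X0; lra.
  by have := mulr_ge0 (ltW e0) X0; have : e * #|X|%:R <= 1 * #|X|%:R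
    by [rewrite ler_wpM2r //; lra]; lra.
move=> h1 h2.
have [mP PAB _ _ Pint] := tl.
have [f inj_f fP] := matching_extend cXY mP.
exists f => // s sS.
have := Pint s sS; have : (#|[set x | f (a s x) != b s (f x)]| + #|intertwined
  a b P s| <= #|X|)%N.
  rewrite -(cardsC [set x | f (a s x) != b s (f x)]) leq_add2l.
  have fst_inj : {in intertwined a b P s &, injective (fun z : X * Y => z.1)}.
    move=> [x y] [x' y']; rewrite !inE => /andP[/fP <- _] /andP[/fP <- _] /= ->.
    by [].
  rewrite -(card_in_imset fst_inj);
    apply/subset_leq_card/fintype.subsetP => _ /imsetP[[x y] + ->].
  by rewrite !inE negbK => /andP[/fP <- /fP ->].
rewrite -(ler_nat K) natrD.
(* The product of [1 - 5 * e] and [1 - 2 * e] is at least [1 - 7 * e], which is why [e] is at most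
   [eps / 7]. *)
have : (1 - 5 * e) * (#|X|%:R - M%:R) <= (1 - 5 * e) * (2 * e * #|X|%:R).
  by rewrite ler_wpM2l; lra.
have : 0 <= e * e * #|X|%:R by rewrite !mulr_ge0 // ltW.
have : 7 * e * #|X|%:R <= eps * #|X|%:R by rewrite ler_wpM2r.
lra.
Qed.

End OrnsteinWeiss.

(** * Strong solutions as approximate actions *)

Section FreeGroupQuotient.
Local Open Scope quotient_scope.
Local Open Scope group_scope.
Variable m : nat.
Implicit Types (x y : free_group m) (rels : set (free_group m)).

Lemma size_reduce (w : seq (letter m)) : (size (reduce w) <= size w)%N.
Proof.
elim: w => //= a w IH; rewrite -/(reduce w); case: (reduce w) IH => //= b v IH.
by case: ifP => _ /=; lia.
Qed.

Lemma word_lengthM x y : (word_length (x * y)%g <= word_length x + word_length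
  y)%N.
Proof. by apply: leq_trans (size_reduce _) _; rewrite size_cat. Qed.

Lemma word_lengthV x : word_length x^-1 = word_length x.
Proof. by rewrite /word_length /= size_rev size_map. Qed.

(** Uniqueness in the universal property of the free group, proved by induction on arbitrary words
    through [reduce]. *)
Lemma fg_eval_unique (H : groupType) (f : free_group m -> H) (p : 'I_m -> H) :
  {morph f : x y / x * y} -> (forall i, f (fg_gen i) = p i) -> fg_eval p =1 f.
Proof.
move=> fM fp.
have f1 : f 1 = 1 by apply: (@mulgI _ (f 1)); rewrite -fM !mulg1.
have fV x : f x^-1 = (f x)^-1.
  by apply: (@mulgI _ (f x)); rewrite -fM !mulgV f1.
have fL a : f (FreeGroup (reduceP [:: a])) = letter_eval p a.
  case: a => i [] /=; rewrite /letter_eval /= -fp; last by congr f;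
    apply: val_inj.
  by rewrite -fV; congr f; apply: val_inj.
have fW w : f (FreeGroup (reduceP w)) = \prod_(a <- w) letter_eval p a.
  elim: w => [|a w IH]; first by rewrite big_nil -f1; congr f; apply: val_inj.
  rewrite big_cons -IH -fL -fM; congr f; apply: val_inj => /=.
  by rewrite -/(reduce w) -[reduced_cons a (reduce w)]/(reduce ([:: a] ++ w))
    -reduce_catl -reduce_catr.
move=> x; rewrite /fg_eval -fW; congr f; apply: val_inj => /=.
by rewrite reduce_id ?fg_reduced.
Qed.

Definition quo rels x : normal_quotient rels := \pi x.

Lemma quoM rels : {morph quo rels : x y / x * y}.
Proof. exact: pi_qg_mul. Qed.

Lemma quo_eq1 rels x : quo rels x = 1 <-> normal_closure rels x.
Proof. exact: pi_qg_eq1. Qed.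

Lemma quo1 rels : quo rels 1 = 1.
Proof. by apply/quo_eq1; case: (normal_closureP rels). Qed.

Lemma quoV rels x : quo rels x^-1 = (quo rels x)^-1.
Proof. by apply: (@mulgI _ (quo rels x)); rewrite -quoM !mulgV quo1. Qed.

Lemma quo_eq rels x y : quo rels x = quo rels y <-> normal_closure rels (x *
  y^-1).
Proof.
rewrite -quo_eq1 quoM quoV; split=> [->|]; first by rewrite mulgV.
by move=> /(congr1 (fun g => g * quo rels y)); rewrite mulgKV mul1g.
Qed.

Lemma quo_repr rels (g : normal_quotient rels) : quo rels (repr g) = g.
Proof. exact: reprK. Qed.

Lemma solution_normal_closure rels n (p : 'I_m -> 'S_n) x :
  solution rels p -> normal_closure rels x -> fg_eval p x = 1.
Proof.
move=> sol /(_ [set y | fg_eval p y = 1]%classic); apply.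
split=> [|y]; last exact: sol.
split=> [|y z|y|y z] /=; rewrite ?fg_eval1 // ?fg_evalM.
- by move=> -> ->; rewrite mulg1.
- by move=> e; apply: (@mulgI _ (fg_eval p y));
  rewrite -fg_evalM mulgV fg_eval1 e mulg1.
- by move=> e; rewrite e mul1g -fg_evalM mulVg fg_eval1.
Qed.

End FreeGroupQuotient.

(** * Hamming estimates for strong solutions *)

Section StrongSolutions.
Local Open Scope ring_scope.
Variables (K : realType) (m : nat) (rels : set (free_group m)).

Lemma card_le_sum (T : finType) (I : eqType) (r : seq I) (B : I -> {set T})
    (A : {set T}) : (forall x, x \in A -> exists2 i, i \in r & x \in B i) ->
  (#|A| <= \sum_(i <- r) #|B i|)%N.
Proof.
elim: r A => [|i r IH] A AB.
  rewrite big_nil leqn0 cards_eq0; apply/eqP/setP => x; rewrite inE.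
  by apply/negP => /AB[].
rewrite big_cons -(finset.cardsID (B i) A) leq_add //.
  by apply/subset_leq_card/finset.subsetIr.
apply: IH => x /setDP[/AB[j + xj] xi].
by rewrite inE => /predU1P[ji|jr]; [rewrite ji (negbTE xi) in xj | exists j].
Qed.

Lemma hammingE n (p q : 'S_n) (c : K) : (1 <= n)%N ->
  (hamming K p q < c) = (#|[set i | p i != q i]%SET|%:R < c * n%:R).
Proof. by move=> n0; rewrite /hamming ltr_pdivrMr // ltr0n. Qed.

Lemma hamming_ltE n (p q : 'S_n) (c : K) : (1 <= n)%N ->
  (1 - c < hamming K p q) = (#|[set i | p i == q i]%SET|%:R < c * n%:R).
Proof.
move=> n0; rewrite /hamming ltr_pdivlMr ?ltr0n // mulrBl mul1r.
have := cardsC [set i | p i == q i]%SET; rewrite card_ord.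
have -> : (~: [set i | p i == q i] = [set i | p i != q i])%SET.
  by apply/setP => i; rewrite !inE.
move=> /(congr1 (fun k => k%:R : K)); rewrite natrD.
by move=> e; apply/idP/idP; lra.
Qed.

Lemma eval_mulV_eq n (p : 'I_m -> 'S_n) (u v : free_group m) i :
  (fg_eval p (u * v^-1)%g i == (1%g : 'S_n) i) = (fg_eval p u i == fg_eval p v
    i).
Proof.
rewrite perm1 fg_evalM permM.
have -> : fg_eval p v^-1%g = (fg_eval p v)^-1%g.
  by apply: (@mulgI _ (fg_eval p v)); rewrite -fg_evalM !mulgV fg_eval1.
by rewrite -(inj_eq (@perm_inj _ (fg_eval p v))) permKV.
Qed.

Lemma lt_inv_of_le (k L : nat) (delta : K) : 0 < delta ->
  delta <= L.+1%:R^-1 -> (k <= L)%N -> k%:R < 1 / delta.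
Proof.
move=> d0 dL kL; rewrite div1r; apply: lt_le_trans (_ : L.+1%:R <= _).
  by rewrite ltr_nat ltnS.
by rewrite -[X in X <= _]invrK lef_pV2 ?posrE ?invr_gt0 ?ltr0n.
Qed.

Lemma strong_solution_agree (delta : K) n (p : 'I_m -> 'S_n) u v L :
  (1 <= n)%N -> 0 < delta -> delta <= L.+1%:R^-1 ->
  (word_length u + word_length v <= L)%N -> strong_solution rels delta p ->
  quo rels u = quo rels v ->
  #|[set i | fg_eval p u i != fg_eval p v i]%SET|%:R < delta * n%:R.
Proof.
move=> n0 d0 dL uvL strong /quo_eq uv.
have len : (word_length (u * v^-1)%g <= L)%N.
  by apply: leq_trans (word_lengthM _ _) _; rewrite word_lengthV.
have [/(_ uv)] := strong _ (lt_inv_of_le d0 dL len); rewrite hammingE //.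
move=> + _; congr (_ < _); congr (_%:R); apply: eq_card => i.
by rewrite !inE eval_mulV_eq.
Qed.

Lemma strong_solution_differ (delta : K) n (p : 'I_m -> 'S_n) u v L :
  (1 <= n)%N -> 0 < delta -> delta <= L.+1%:R^-1 ->
  (word_length u + word_length v <= L)%N -> strong_solution rels delta p ->
  quo rels u <> quo rels v ->
  #|[set i | fg_eval p u i == fg_eval p v i]%SET|%:R < delta * n%:R.
Proof.
move=> n0 d0 dL uvL strong /quo_eq uv.
have len : (word_length (u * v^-1)%g <= L)%N.
  by apply: leq_trans (word_lengthM _ _) _; rewrite word_lengthV.
have [_ /(_ uv)] := strong _ (lt_inv_of_le d0 dL len); rewrite hamming_ltE //.
congr (_ < _); congr (_%:R); apply: eq_card => i.
by rewrite !inE eval_mulV_eq.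
Qed.

Lemma seq_bound (T : eqType) (r : seq T) (f : T -> nat) :
  exists L, forall x, x \in r -> (f x <= L)%N.
Proof.
elim: r => [|y r [L Lr]]; first by exists 0%N.
exists (maxn (f y) L) => x; rewrite inE => /predU1P[->|/Lr xL].
  exact: leq_maxl.
exact: leq_trans xL (leq_maxr _ _).
Qed.

(** Each class acts through a chosen representative word, hence by a permutation, but products need
    not be respected. *)
Definition quo_action n (p : 'I_m -> 'S_n) (g : normal_quotient rels) : 'I_n ->
  'I_n :=
  fg_eval p (repr g).

Lemma strong_solution_good_points (Q : seq (normal_quotient rels)) (t : K) :
  0 < t -> exists2 d : K, 0 < d & forall (delta : K) n (p : 'I_m -> 'S_n),
    0 < delta -> delta <= d -> (1 <= n)%N -> strong_solution rels delta p ->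
    #|~: good_points Q (quo_action p)|%:R <= t * n%:R.
Proof.
move=> t0; pose r := [seq (g, h) | g <- Q, h <- Q].
have [L LP] := seq_bound r (fun z => word_length (repr z.1) + word_length (repr
  z.2)
  + word_length (repr (z.1 * z.2)%g))%N.
(* The first bound makes all words involved short enough to be tested; the second shares [t] among
   the pairs in [r], each with two ways to fail. The successor keeps it positive when [Q] is
   empty. *)
exists (Num.min L.+1%:R^-1 (t / (2 * (size r).+1%:R))).
  by rewrite lt_min invr_gt0 ltr0n divr_gt0 ?mulr_gt0 ?ltr0n.
move=> delta n p d0; rewrite le_min => /andP[dL dt] n0 strong.
pose B (z : normal_quotient rels * normal_quotient rels) := [set i | fg_eval p
  (repr z.1 * repr z.2)%g i
    != fg_eval p (repr (z.1 * z.2)%g) i]%SET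
  :|: (if z.1 == z.2 then finset.set0
       else [set i | fg_eval p (repr z.1) i == fg_eval p (repr z.2) i]%SET).
have Ble z : z \in r -> #|B z|%:R <= 2 * delta * n%:R.
  move=> zr; have zL := LP z zr.
  have dn : 0 <= delta * n%:R by rewrite mulr_ge0 // ltW.
  apply: le_trans (_ : _ <= (#|[set i | fg_eval p (repr z.1 * repr z.2)%g i
    != fg_eval p (repr (z.1 * z.2)%g) i]%SET| + #|if z.1 == z.2 then finset.set0
       else [set i | fg_eval p (repr z.1) i == fg_eval p (repr z.2)
         i]%SET|)%:R) _.
    by rewrite ler_nat leq_card_setU.
  rewrite natrD -mulrA mulr_natl mulr2n lerD //.
    apply/ltW/(strong_solution_agree n0 d0 dL _ strong).
      by apply: leq_trans zL; rewrite leq_add2r word_lengthM.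
    by rewrite quoM !quo_repr.
  case: eqP => [_|ne]; first by rewrite cards0.
  apply/ltW/(strong_solution_differ n0 d0 dL _ strong);
    last by rewrite !quo_repr.
  exact: leq_trans (leq_addr _ _) zL.
apply: le_trans (_ : (\sum_(z <- r) #|B z|)%:R <= _).
  rewrite ler_nat; apply: card_le_sum => i.
  rewrite !inE => /allPn[g gQ /allPn[h hQ gh]].
  exists (g, h); first by apply/allpairsP; exists (g, h).
  rewrite !inE /=; move: gh; rewrite negb_and negb_or negbK.
  rewrite /quo_action fg_evalM permM => /orP[->//|/andP[/negbTE-> e]].
  by rewrite inE e orbT.
rewrite natr_sum big_seq; apply: le_trans (ler_sum _ Ble) _.
rewrite -big_seq big_const_seq count_predT iter_addr_0 -[leLHS]mulr_natl.
have n0' : 0 <= n%:R :> K by [].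
rewrite mulrA ler_wpM2r //.
move: dt; rewrite ler_pdivlMr ?mulr_gt0 ?ltr0n // -natr1.
lra.
Qed.

End StrongSolutions.

(** * Residually finite groups are weakly stable *)

Section FiniteQuotientModels.
Local Open Scope ring_scope.

Lemma residually_finite_separates (G : groupType) (Q : seq G) :
  residually_finite G -> exists (H : finGroupType) (f : G -> H),
    {morph f : x y / (x * y)%g} /\ {in Q, forall g, g <> 1%g -> f g <> 1%g}.
Proof.
move=> rf; elim: Q => [|g Q [H [f [fM fQ]]]].
  by exists {perm 'I_1}, (fun=> 1%g); split => // x y; rewrite mulg1.
have [g1|g1] := eqVneq g 1%g.
  exists H, f; split => // h; rewrite inE => /predU1P[->//|]; exact: fQ.
have [H' [f' f'g]] := rf g (fun e => negP g1 (introT eqP e)).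
exists (H' * H)%type, (fun x => (f' x, f x)); split => [x y|h].
  by rewrite gmulfM fM.
rewrite inE => /predU1P[-> _ [/f'g//]|hQ h1 [_]].
exact: fQ.
Qed.

(** This is [q] copies of the right regular action of [H], padded with [r] fixed points to reach any
    prescribed number of points. *)
Definition model_action (G : groupType) (H : finGroupType) (f : G -> H) q r
    (g : G) (y : H * 'I_q + 'I_r) : H * 'I_q + 'I_r :=
  if y is inl (h, c) then inl ((h * f g)%g, c) else y.

Section Model.
Variables (G : groupType) (H : finGroupType) (f : G -> H) (q r : nat).
Hypothesis fM : {morph f : x y / (x * y)%g}.
Local Notation act := (@model_action G H f q r).

Lemma model_actionM g h y : act (g * h)%g y = act h (act g y).
Proof. by case: y => [[x c]|//] /=; rewrite fM mulgA. Qed.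

Lemma model_action_inj g : injective (act g).
Proof.
by move=> [[x c]|i] [[x' c']|i'] //= [/mulIg -> ->].
Qed.

(** Right multiplication in [H] is free and [f] separates the elements of [Q], so only the fixed
    points can be bad. *)
Lemma model_good_points (Q : seq G) :
  {in [seq (g^-1 * h)%g | g <- Q, h <- Q], forall g, g <> 1%g -> f g <> 1%g} ->
  (#|~: good_points Q act| <= r)%N.
Proof.
move=> fQ; rewrite -[leqRHS]card_ord -(card_imset _ (@inr_inj (H * 'I_q) 'I_r)).
apply/subset_leq_card/fintype.subsetP => -[[x c]|i]; last first.
  by move=> _; apply/imsetP; exists i.
rewrite !inE => /negP[]; apply/allP => g gQ; apply/allP => h hQ.
rewrite -model_actionM eqxx /=; have [//|gh] := eqVneq g h.
apply/eqP => -[/mulgI fgh]; apply: (fQ (g^-1 * h)%g).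
- by apply/allpairsP; exists (g, h).
- by move=> /(congr1 (fun x => g * x)%g); rewrite mulVKg mulg1 => hg;
  rewrite hg eqxx in gh.
apply: (@mulgI _ (f g)); rewrite -fM mulVKg mulg1; exact/esym.
Qed.

End Model.

End FiniteQuotientModels.

Section ResiduallyFiniteStable.
Local Open Scope ring_scope.
Variables (K : realType) (m : nat) (rels : set (free_group m)).
Local Notation G := (normal_quotient rels).

(** Hamming distances are multiples of [1 / n], so a distance below [delta] vanishes when
    [delta * n < 1]. *)
Lemma strong_solution_small (delta : K) n (p : 'I_m -> 'S_n) L :
  (1 <= n)%N -> 0 < delta -> delta <= L.+1%:R^-1 ->
  (forall x, rels x -> (word_length x <= L)%N) -> delta * n%:R < 1 ->
  strong_solution rels delta p -> solution rels p.
Proof.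
move=> n0 d0 dL relsL dn strong x rx.
have nx : normal_closure rels x by move=> N [_]; apply.
have [/(_ nx)] := strong _ (lt_inv_of_le d0 dL (relsL _ rx)).
rewrite hammingE // => lt _; move: (lt_trans lt dn).
rewrite ltrn1 ltnS leqn0 cards_eq0 => /eqP e; apply/permP => i.
by apply/eqP; move/setP/(_ i): e; rewrite !inE => /negbFE.
Qed.

(** An exact action of [G] carried back along a bijection is a homomorphism from [G], so its values
    at the generators satisfy [rels]. *)
Lemma conjugate_solution n (Y : finType) (act : G -> Y -> Y) (f : 'I_n -> Y) :
  #|Y| = n -> injective f -> (forall g, injective (act g)) ->
  (forall g h y, act (g * h)%g y = act h (act g y)) ->
  exists2 q : 'I_m -> 'S_n, solution rels q &
    forall i x, f (q i x) = act (quo rels (fg_gen i)) (f x).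
Proof.
move=> cY inj_f inj_act actM.
have [f' fK f'K] : bijective f by apply: inj_card_bij; rewrite // cY card_ord.
have inj_c g : injective (fun x => f' (act g (f x))).
  by move=> x y /(can_inj f'K)/inj_act/inj_f.
pose rho g : 'S_n := perm (inj_c g).
have rhoM : {morph rho : g h / (g * h)%g}.
  by move=> g h; apply/permP => x; rewrite permM !permE f'K actM.
have rho1 : rho 1%g = 1%g by apply: (@mulgI _ (rho 1%g)); rewrite -rhoM !mulg1.
exists (fun i => rho (quo rels (fg_gen i))); last by move=> i x;
  rewrite permE f'K.
move=> x rx; rewrite (@fg_eval_unique _ _ (rho \o quo rels)) //=.
- suff /quo_eq1 -> : normal_closure rels x by [].
  by move=> N [_]; apply.
- by move=> y z; rewrite /= quoM rhoM.
Qed.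

Theorem residually_finite_weakly_stable : finite_set rels -> amenable K G ->
  residually_finite G -> weakly_stable K rels.
Proof.
move=> /finite_seqP[rs rsE] am rf eps eps0.
pose S := [seq quo rels (fg_gen i) | i <- enum 'I_m].
have e2 : 0 < eps / 4 by rewrite divr_gt0.
have [Q [t t0 conj]] := almost_conjugate S am e2.
have [H [f [fM fQ]]] :=
  residually_finite_separates [seq (g^-1 * h)%g | g <- Q, h <- Q] rf.
have [d1 d10 good] := strong_solution_good_points Q t0.
have [L1 L1P] := seq_bound rs (@word_length m).
have [L2 L2P] := seq_bound (enum 'I_m) (fun i : 'I_m =>
  word_length (repr (quo rels (fg_gen i))) + word_length (fg_gen i))%N.
have H0 : 0 < #|H|%:R :> K by rewrite ltr0n; apply/card_gt0P; exists 1%g.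
have [d d0 [dd1 dL dt de]] : exists2 d : K, 0 < d & [/\ d <= d1,
    d <= (L1 + L2).+1%:R^-1, d <= t / (2 * #|H|%:R) & d <= eps / 4].
  exists (Num.min (Num.min d1 (L1 + L2).+1%:R^-1) (Num.min (t / (2 * #|H|%:R))
    (eps / 4))).
    by rewrite !lt_min d10 e2 invr_gt0 ltr0n divr_gt0 // mulr_gt0.
  by split; rewrite !ge_min lexx ?orbT.
exists d => // n p n0 strong.
have n0' : 0 < n%:R :> K by rewrite ltr0n.
have [small|large] := ltP (d * n%:R) 1.
  exists p => [|i].
    apply: (strong_solution_small n0 d0 dL _ small strong) => x.
    by rewrite rsE => /L1P xL; apply: leq_trans xL (leq_addr _ _).
  rewrite hammingE // (_ : [set _ | _]%SET = finset.set0) ?cards0 ?mulr_gt0 //.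
  by apply/setP => j; rewrite !inE eqxx.
(* The bound [d <= t / (2 * |H|)] turns [1 <= d * n] into this estimate, so the fewer than [|H|]
   padding points are negligible. *)
have Hn : #|H|%:R <= t * n%:R.
  have : d * n%:R <= t / (2 * #|H|%:R) * n%:R by rewrite ler_pM2r.
  move=> /(le_trans large); rewrite mulrAC ler_pdivlMr ?mulr_gt0 //; lra.
pose q := (n %/ #|H|)%N; pose r := (n %% #|H|)%N.
pose Y : finType := (H * 'I_q + 'I_r)%type.
have cY : #|{: Y}| = n.
  by rewrite card_sum card_prod !card_ord mulnC -divn_eq.
pose b : G -> Y -> Y := @model_action G H f q r.
have good_b : #|~: good_points Q b|%:R <= t * #|'I_n|%:R.
  rewrite card_ord; apply: le_trans Hn; rewrite ler_nat.
  apply: leq_trans (model_good_points q r fM fQ) _.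
  by rewrite ltnW // ltn_mod -(ltr0n K).
have good_a : #|~: good_points Q (@quo_action m rels n p)|%:R <= t * #|'I_n|%:R.
  by rewrite card_ord; apply: good strong.
have inj_a g : injective (@quo_action m rels n p g) by apply: perm_inj.
have [|s inj_s sP] := conj _ Y _ b inj_a (@model_action_inj G H f q r) _ good_a
  good_b.
  by rewrite card_ord cY.
have [u sol uP] := conjugate_solution cY inj_s (@model_action_inj G H f q r)
  (model_actionM fM).
exists u => // i; rewrite hammingE //.
pose si := quo rels (fg_gen i).
have c1 : #|[set x | s (quo_action p si x) != b si (s x)]%SET|%:R <= eps / 4 *
  n%:R.
  by rewrite -[n in leRHS]card_ord; apply: sP; apply/mapP; exists i;
    rewrite ?mem_enum.
have c2 : #|[set x | fg_eval p (repr si) x != fg_eval p (fg_gen i) x]%SET|%:R <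
  d * n%:R.
  apply: (strong_solution_agree n0 d0 dL _ strong); last by rewrite quo_repr.
  by apply: leq_trans (L2P i _) (leq_addl _ _); rewrite mem_enum.
(* Where [p i] and [u i] differ, either [s] fails to intertwine, or the representative of [si] acts
   differently from the generator itself. Each happens on at most [eps / 4 * n] points. *)
have c3 : (#|[set x | p i x != u i x]%SET| <=
    #|[set x | s (quo_action p si x) != b si (s x)]%SET|
    + #|[set x | fg_eval p (repr si) x != fg_eval p (fg_gen i) x]%SET|)%N.
  apply: leq_trans (leq_card_setU _ _);
    apply/subset_leq_card/fintype.subsetP => x.
  rewrite !inE; apply: contraR;
    rewrite negb_or !negbK => /andP[/eqP e1 /eqP e3].
  apply/eqP/inj_s; rewrite uP -[RHS]e1; congr s.
  by rewrite /quo_action e3 fg_eval_gen.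
have c4 : d * n%:R <= eps / 4 * n%:R by rewrite ler_pM2r.
have c5 : 0 < eps * n%:R by rewrite mulr_gt0.
move: c3; rewrite -(ler_nat K) natrD; lra.
Qed.

End ResiduallyFiniteStable.

(** * Weakly stable groups are residually finite *)

Section StableResiduallyFinite.
Local Open Scope ring_scope.
Variables (K : realType) (m : nat) (rels : set (free_group m)).
Local Notation G := (normal_quotient rels).

Definition word_quo (w : seq (letter m)) : G :=
  (\prod_(a <- w) letter_eval (fun i => quo rels (fg_gen i)) a)%g.

Lemma word_quoE x : word_quo (fg_word x) = quo rels x.
Proof. exact: (fg_eval_unique (@quoM m rels)). Qed.

(* Translation by the generators on a finite set [F], completed arbitrarily to
   permutations where it leaves [F]. *)
Lemma partial_translations (F : {fset G}) (n : nat) : #|` F| = n ->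
  exists (e : 'I_n -> G) (p : 'I_m -> 'S_n), [/\ injective e,
    forall g, g \in F -> exists x, e x = g, forall x, e x \in F
    & forall a x, (e x * word_quo [:: a])%g \in F ->
        e (letter_eval p a x) = (e x * word_quo [:: a])%g].
Proof.
move=> cF; pose e (x : 'I_n) := nth 1%g F x.
have eF x : e x \in F by rewrite mem_nth // cF.
have inj_e : injective e.
  move=> x y /eqP; rewrite nth_uniq ?cF ?fset_uniq // => /eqP; exact: val_inj.
have surj_e g : g \in F -> exists x, e x = g.
  move=> gF; have lt : (index g F < n)%N by rewrite -cF index_mem.
  by exists (Ordinal lt); rewrite /e /= nth_index.
pose s i := quo rels (fg_gen i).
have /choice[p pP] i : exists u : 'S_n, forall x y, (e x * s i)%g = e y -> u x
  = y.
  pose P : {set 'I_n * 'I_n} := [set z | (e z.1 * s i)%g == e z.2]%SET.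
  have [|f inj_f fP] := @matching_extend _ _ P erefl.
    split=> [x y y'|x x' y]; rewrite !inE /= => /eqP e1 /eqP e2.
      by apply: inj_e; rewrite -e1.
    by apply: inj_e; apply: (@mulIg _ (s i)); rewrite e1.
  by exists (perm inj_f) => x y xy; rewrite permE; apply: fP; rewrite inE xy.
exists e, p; split => // -[i b] x; rewrite /word_quo big_seq1 /letter_eval /=.
case: b => /surj_e[y yE]; rewrite -yE; last by rewrite (pP i x y).
congr e; apply: (@perm_inj _ (p i)); rewrite permKV; apply/esym/pP.
by rewrite yE mulgKV.
Qed.

(** The path of [e x] along the prefixes of [w] stays in [F], so the arbitrary completion of the
    translations is never met. *)
Lemma translation_word (F : {fset G}) n (e : 'I_n -> G) (p : 'I_m -> 'S_n) w x :
  (forall a x, (e x * word_quo [:: a])%g \in F ->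
     e (letter_eval p a x) = (e x * word_quo [:: a])%g) ->
  (forall k, (e x * word_quo (take k w))%g \in F) ->
  e ((\prod_(a <- w) letter_eval p a)%g x) = (e x * word_quo w)%g.
Proof.
move=> ep; elim: w x => [|a w IH] x wF.
  by rewrite /word_quo !big_nil perm1 mulg1.
have wqS v : word_quo (a :: v) = (word_quo [:: a] * word_quo v)%g.
  by rewrite /word_quo big_cons big_seq1.
have ea : e (letter_eval p a x) = (e x * word_quo [:: a])%g.
  by apply: ep; have := wF 1%N; rewrite /= take0.
have {}IH := IH (letter_eval p a x); rewrite ea in IH.
rewrite big_cons permM wqS mulgA; apply: IH => k.
by rewrite -mulgA -wqS; apply: (wF k.+1).
Qed.

(** Off a small set [B], words of length at most [L] act on a Folner set by right translation in
    [G], which fixes every point or none according to whether the word is trivial in [G]. *)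
Lemma strong_solution_exists (delta : K) : amenable K G -> 0 < delta ->
  exists (n : nat) (p : 'I_m -> 'S_n), (1 <= n)%N /\ strong_solution rels delta
    p.
Proof.
move=> am d0; pose L := Num.bound (1 / delta).
have LP k : k%:R < 1 / delta -> (k <= L)%N.
  move=> kd; rewrite -(ler_nat K) ltW // (lt_trans kd) // archi_boundP //.
  by rewrite divr_ge0 // ltW.
pose S := [seq word_quo (val w) | w <- enum {: L.-bseq (letter m)}].
have inS w : (size w <= L)%N -> word_quo w \in S.
  by move=> wL; apply/mapP; exists (Bseq wL); rewrite ?mem_enum.
(* Summing over [S] costs [size S * eta], and the successor keeps this strictly below [delta]. *)
pose eta := delta / (size S).+1%:R.
have eta0 : 0 < eta by rewrite divr_gt0 ?ltr0n.
have [F [F0 inv]] := amenable_folner S am eta0.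
have n0 : (0 < #|` F|)%N by rewrite cardfs_gt0.
have [e [p [inj_e surj_e eF ep]]] := partial_translations (erefl #|` F|).
set n := #|` F| in e p inj_e surj_e eF ep n0 *.
have n0' : 0 < n%:R :> K by rewrite ltr0n.
pose B : {set 'I_n} := [set x | has (fun s => (e x * s)%g \notin F) S]%SET.
have cB : #|B|%:R < delta * n%:R.
  apply: le_lt_trans (_ : (size S)%:R * (eta * n%:R) < _); last first.
    rewrite mulrA ltr_pM2r // /eta mulrCA gtr_pMr // ltr_pdivrMr ?ltr0n //
      mul1r.
    by rewrite ltr_nat.
  apply: le_trans (_ : (\sum_(s <- S) #|[set x | (e x * s)%g \notin F]%SET|)%:R
    <= _).
    rewrite ler_nat; apply: card_le_sum => x.
    by rewrite inE => /hasP[s sS xs]; exists s; rewrite // inE.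
  rewrite natr_sum big_seq.
  apply: le_trans (_ : \sum_(s <- S | s \in S) eta * n%:R <= _); last first.
    by rewrite -big_seq big_const_seq count_predT iter_addr_0 mulr_natl.
  apply: ler_sum => s sS; apply: le_trans (inv s sS); rewrite ler_nat.
  rewrite cardE -(size_map e) -size_filter; apply: uniq_leq_size.
    by rewrite map_inj_uniq ?enum_uniq.
  move=> _ /mapP[x + ->]; rewrite mem_enum inE mem_filter => ->.
  exact: eF.
have evalE x xi : x \notin B -> (word_length xi <= L)%N ->
    e (fg_eval p xi x) = (e x * quo rels xi)%g.
  move=> xB xiL; rewrite -word_quoE; apply: translation_word ep _ => k.
  apply: contraR xB => nF.
  have sS : word_quo (take k (fg_word xi)) \in S.
    by apply: inS; rewrite size_take; case: ltnP => // /ltnW kl;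
      apply: leq_trans xiL.
  by rewrite inE; apply/hasP; exists (word_quo (take k (fg_word xi))).
exists n, p; split=> // xi /LP xiL; rewrite hammingE // hamming_ltE //.
split=> [/quo_eq1 xi1|xi1]; apply: le_lt_trans cB; rewrite ler_nat;
  apply/subset_leq_card/fintype.subsetP => x; rewrite inE;
    apply: contraTT => xB.
- by rewrite negbK; apply/eqP/inj_e; rewrite evalE // xi1 mulg1 perm1.
apply/eqP => /(congr1 e); rewrite evalE // perm1 => xx; apply: xi1.
by apply/quo_eq1; apply: (@mulgI _ (e x)); rewrite xx mulg1.
Qed.

(** Errors add up letter by letter: the first letter acts bijectively, so pulling back the error set
    of the remaining word preserves its size. *)
Lemma card_eval_diff n (p q : 'I_m -> 'S_n) (c : K) (w : seq (letter m)) :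
  (forall i, #|[set x | p i x != q i x]%SET|%:R <= c) ->
  #|[set x | (\prod_(a <- w) letter_eval p a)%g x
       != (\prod_(a <- w) letter_eval q a)%g x]%SET|%:R <= (size w)%:R * c.
Proof.
move=> pq.
have pqa a : #|[set x | letter_eval p a x != letter_eval q a x]%SET|%:R <= c.
  case: a => i []; rewrite /letter_eval /=; last exact: pq.
  apply: le_trans (pq i); rewrite ler_nat.
  rewrite -(card_imset _ (@perm_inj _ (p i))).
  apply/subset_leq_card/fintype.subsetP => x; rewrite inE => ne.
  apply/imsetP; exists ((p i)^-1%g x); rewrite ?permKV // inE permKV.
  by apply: contra ne => /eqP {2}->; rewrite permK.
elim: w => [|a w IH].
  by rewrite mul0r (_ : [set _ | _]%SET = finset.set0) ?cards0 //;
    apply/setP => x; rewrite !inE !big_nil eqxx.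
pose D := [set x | (\prod_(a <- w) letter_eval p a)%g x
  != (\prod_(a <- w) letter_eval q a)%g x]%SET.
apply: le_trans (_ : (#|[set x | letter_eval p a x != letter_eval q a x]%SET|
    + #|letter_eval p a @^-1: D|)%:R <= _).
  rewrite ler_nat; apply: leq_trans (leq_card_setU _ _).
  apply/subset_leq_card/fintype.subsetP => x; rewrite !inE !big_cons !permM.
  by have [<-|//] := eqVneq (letter_eval p a x) (letter_eval q a x).
rewrite card_preimset; last exact: perm_inj.
by rewrite natrD -natr1 mulrDl mul1r addrC lerD.
Qed.

Theorem weakly_stable_residually_finite : amenable K G ->
  weakly_stable K rels -> residually_finite G.
Proof.
move=> am stable g g1; pose l := word_length (repr g).
have l0 : 0 < l.+1%:R :> K by rewrite ltr0n.
(* With this constant the word of length [l] changes on at most half of the points when [p] is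
   replaced by [q]. As [p] makes it fix fewer than half of them, [q] cannot make it the identity. *)
have [|d d0 dP] := stable (1 / (2 * l.+1%:R));
  first by rewrite divr_gt0 ?mulr_gt0.
pose d' := Num.min (Num.min d (1 / 2)) l.+1%:R^-1.
have d'0 : 0 < d' by rewrite !lt_min d0 invr_gt0 l0 divr_gt0.
have d'd : d' <= d by rewrite !ge_min lexx.
have d'h : d' <= 1 / 2 by rewrite !ge_min lexx orbT.
have d'l : d' <= l.+1%:R^-1 by rewrite !ge_min lexx orbT.
have [n [p [n0 strong]]] := strong_solution_exists am d'0.
have n0' : 0 < n%:R :> K by rewrite ltr0n.
have [|q sol pq] := dP n p n0.
  move=> xi xid; have [|s1 s2] := strong xi.
    by apply: lt_le_trans xid _; rewrite !div1r lef_pV2.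
  split=> [/s1 lt|/s2 lt]; first exact: lt_le_trans d'd.
  by apply: le_lt_trans lt; rewrite lerD2l lerN2.
have qg : fg_eval q (repr g) <> 1%g.
  move=> qg1.
  have c1 : #|[set x | fg_eval p (repr g) x != fg_eval q (repr g) x]%SET|%:R
      <= l%:R * (1 / (2 * l.+1%:R) * n%:R) :> K.
    by apply: card_eval_diff => i; apply: ltW; rewrite -hammingE.
  have c2 : #|[set x | fg_eval p (repr g) x == fg_eval p 1%g x]%SET|%:R < d' *
    n%:R.
    apply: (strong_solution_differ n0 d'0 d'l _ strong); first by rewrite addn0.
    by rewrite quo_repr quo1.
  have := cardsC [set x | fg_eval p (repr g) x != fg_eval q (repr g) x]%SET.
  rewrite card_ord (_ : ~: _ =
    [set x | fg_eval p (repr g) x == fg_eval p 1%g x]%SET); last first.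
    by apply/setP => x; rewrite !inE negbK qg1 fg_eval1.
  move=> /(congr1 (fun k => k%:R : K)); rewrite natrD.
  have c3 : d' * n%:R <= 1 / 2 * n%:R by rewrite ler_pM2r.
  have c4 : l%:R * (1 / (2 * l.+1%:R)) <= 1 / 2 :> K.
    rewrite div1r ler_pdivrMr ?mulr_gt0 // -[l.+1%:R]natr1; lra.
  have := ler_wpM2r (ltW n0') c4; rewrite -mulrA => c5 e.
  have := le_trans c1 c5; have := lt_le_trans c2 c3; lra.
(* As [q] kills the normal closure exactly, the choice of representatives does not affect
   multiplicativity. *)
pose f (h : G) : 'S_n := fg_eval q (repr h).
have fM : {morph f : x y / (x * y)%g}.
  move=> x y; rewrite /f -fg_evalM;
    apply: (@mulIg _ (fg_eval q (repr x * repr y)^-1%g)).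
  rewrite -!fg_evalM mulgV fg_eval1; apply: (solution_normal_closure sol).
  by apply/quo_eq; rewrite quoM !quo_repr.
pose fH := isMultiplicative.Build G 'S_n f fM.
pose fS : {multiplicative G -> 'S_n} := HB.pack f fH.
by exists {perm 'I_n}, fS.
Qed.

End StableResiduallyFinite.

Theorem theorem1p1 (K : realType) (m : nat) (rels : set (free_group m)) :
  (1 <= m)%N -> finite_set rels ->
  amenable K (normal_quotient rels) ->
  (weakly_stable K rels <-> residually_finite (normal_quotient rels)).
Proof.
move=> _ fin am; split; first exact: weakly_stable_residually_finite.
exact: residually_finite_weakly_stable.
Qed.
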